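(* Let $K$ be a field of characteristic zero and let $f_1,\ldots,f_n\in K[x]$ be nonconstant polynomials over $K$ in one variable. Suppose that the linear polynomials amongst the $f_i$'s form an independent sequence. Let $\Phi:\mathbb A^n_K\to\mathbb A^n_K$ be given by $(x_1,\ldots,x_n)\mapsto(f_1(x_1),\ldots,f_n(x_n))$. Then there is a point $a\in\mathbb A^n(K)$ for which the forward orbit $\mathcal O_\Phi(a)$ is Zariski dense in $\mathbb A^n_K$.
   Context: Linear polynomial means polynomial of degree one. $\mathcal O_\Phi(a):=\{\Phi^{\circ m}(a):m\in\mathbb N\}$, where $\Phi^{\circ m}$ is the $m$-fold iterate. A sequence of linear polynomials $g_1,\ldots,g_r\in K[x]$ is independent if either the numbers $g_1'(0),\ldots,g_r'(0)$ are multiplicatively independent, or the multiplicative group generated by $g_1'(0),\ldots,g_r'(0)$ has rank $r-1$ and for some $j\le r$ we have $g_j(x)=x+b$ with $b\ne0$. (The empty sequence is independent.) *)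

(* Defs.v *)
From HB Require Import structures.
From mathcomp Require Import all_boot all_order all_algebra.
From mathcomp Require Import mpoly.

Set Implicit Arguments.
Unset Strict Implicit.
Unset Printing Implicit Defensive.

Import GRing.Theory.
Local Open Scope ring_scope.

Section MultiplicativeIndependence.
Variable K : fieldType.

Definition exp_prod (s : seq K) (e : 'I_(size s) -> int) : K :=
  \prod_(i < size s) s`_i ^ e i.

(* The condition 0 \notin s is needed because 0^-1 = 0 in MathComp: otherwise
   [:: 0] would count as independent. *)
Definition mult_independent (s : seq K) : Prop :=
  0 \notin s /\
  forall e : 'I_(size s) -> int, exp_prod e = 1 -> forall i, e i = 0.

Definition mult_group (s : seq K) (x : K) : Prop :=
  exists e : 'I_(size s) -> int, x = exp_prod e.

Definition has_mult_rank (G : K -> Prop) (r : nat) : Prop :=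
  (exists t : seq K,
     [/\ size t = r, forall x, x \in t -> G x & mult_independent t]) /\
  (forall t : seq K,
     (forall x, x \in t -> G x) -> mult_independent t -> (size t <= r)%N).

(* [size p] is the degree plus one. *)
Definition linear_poly (p : {poly K}) : bool := size p == 2.

Definition slopes (g : seq {poly K}) : seq K := [seq (p^`()).[0] | p <- g].

(* In the second case g is nonempty, so (size g).-1 is not truncated. *)
Definition independent_linear (g : seq {poly K}) : Prop :=
  all linear_poly g /\
  (mult_independent (slopes g) \/
   (has_mult_rank (mult_group (slopes g)) (size g).-1 /\
    exists2 b : K, b != 0 & 'X + b%:P \in g)).

End MultiplicativeIndependence.

Section AffineSpace.
Variables (K : fieldType) (n : nat).

(* The underlying set of the scheme A^n_K: prime ideals of K[x_1, ..., x_n],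
   encoded as in ring_quotient by boolean predicates. *)
Definition affine_space := prime_idealr {mpoly K[n]}.

(* The closed sets are the V(P), for P a set of polynomials. *)
Definition zariski_closed (Z : affine_space -> Prop) : Prop :=
  exists P : {mpoly K[n]} -> Prop,
    forall y : affine_space,
      Z y <-> (forall p, P p -> (y : {mpoly K[n]} -> bool) p).

Definition vanishing_ideal (a : {ffun 'I_n -> K}) : {mpoly K[n]} -> bool :=
  fun p => p.@[a] == 0.

Lemma vanishing_ideal_closed a : idealr_closed (vanishing_ideal a).
Proof.
split; rewrite ?unfold_in /vanishing_ideal ?meval0 ?meval1 ?oner_eq0 //.
move=> c u v; rewrite !unfold_in /vanishing_ideal => /eqP u0 /eqP v0.
by rewrite mevalD mevalM u0 v0 mulr0 addr0.
Qed.

Lemma vanishing_ideal_prime a : prime_idealr_closed (vanishing_ideal a).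
Proof.
by move=> u v; rewrite !unfold_in /vanishing_ideal mevalM mulf_eq0.
Qed.

HB.instance Definition _ a :=
  isIdealr.Build {mpoly K[n]} (vanishing_ideal a) (vanishing_ideal_closed a).
HB.instance Definition _ a :=
  isPrimeIdealrClosed.Build {mpoly K[n]} (vanishing_ideal a)
    (@vanishing_ideal_prime a).

(* The point of the scheme A^n_K given by a K-rational point. *)
Definition rational_point (a : {ffun 'I_n -> K}) : affine_space :=
  vanishing_ideal a.

Definition zariski_dense (S : {ffun 'I_n -> K} -> Prop) : Prop :=
  forall Z : affine_space -> Prop, zariski_closed Z ->
    (forall a, S a -> Z (rational_point a)) -> forall y, Z y.

Definition split_map (f : 'I_n -> {poly K}) (x : {ffun 'I_n -> K}) :
  {ffun 'I_n -> K} := [ffun i => (f i).[x i]].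

End AffineSpace.

Definition forward_orbit (T : Type) (phi : T -> T) (a x : T) : Prop :=
  exists m : nat, x = iter m phi a.

(* Main.v *)
From HB Require Import structures.
Require Import Defs.
From mathcomp Require Import all_boot all_order all_algebra.
From mathcomp Require Import mpoly.
From mathcomp Require Import all_field boolp.
From mathcomp Require Import ring zify.

Import GRing.Theory.
Local Open Scope ring_scope.

(** Why a dense orbit exists.

    A point has a dense forward orbit as soon as no nonzero polynomial [p]
    vanishes along it.  Up to a translation of the coordinates, a linear
    coordinate of the orbit is [al ^+ m] or [m * b] ([iter_linear],
    [iter_translation]), so by independence of the slopes the monomials in the
    linear coordinates are distinct exponential polynomials in [m], which are
    linearly independent ([exp_poly_free]).  The point is to choose the
    coordinates [a j] at which [f j] has degree at least two so that their orbits
    are independent of each other and of all exponential polynomials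
    ([nonlinear_separation]).

    Over a number field this is done by attaching to each nonlinear index [i] a
    prime [p i] with a discrete valuation ring [O i] of residue field F_p and
    uniformizer [p i].  The start [a i] is a rational number with [p i] exactly
    once in its denominator; hence its orbit goes to infinity at [i]
    ([escaping_iterate]).  For [j] different from [i], [a j] is congruent modulo
    [p i] to a fixed point of [f j] whose multiplier is a unit; on that residue
    disc [f j] is injective modulo every power of [p i], so that the orbit of
    [a j], living in a finite set, is purely periodic modulo every power
    ([recurrent_iterate]).  The sequences killed by a product of operators
    (shift - g), with [g] a unit, are purely periodic in the same sense
    ([linrec_recurrent]).  Now let a relation [\sum_e C e m * y m ^+ e = 0] hold
    for all [m], where [y] is the orbit at [i] and the [C e] are built from the
    other sequences.  As [y] goes to infinity, the top coefficient [C E m] tends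
    to 0; as it is purely periodic modulo every power of [p i], it is 0 for every
    [m] ([elimination]).  Thus one nonlinear coordinate after the other can be
    eliminated ([linrec_separation]).

    The fixed points are only algebraic over the field of coefficients, and must
    be rational modulo [p i].  This is arranged by taking a primitive element
    [th] of a number field that contains everything, and a prime [p] that divides
    a value [h.[n]] of its minimal polynomial; there are infinitely many of them
    ([prime_divides_value], [unramified_place_exists]).

    A general [K] is reduced to a number field by specialization: the finitely
    many coefficients generate a ring [R], which maps to the algebraic numbers
    ([specializable_poly], in the manner of the Nullstellensatz).  The map is not
    injective and may destroy the independence of the slopes.  But the family of
    solutions of a linear recurrence has a basis defined over [R], the assertion
    that the relation above has only the trivial solution says that some minors
    do not vanish, and a minor that does not vanish after specialization does not
    vanish in [K] ([independence_lift], [separation_lift]).  Only over [K] are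
    the slopes used. *)

Set Implicit Arguments.
Unset Strict Implicit.
Unset Printing Implicit Defensive.

(** * Characteristic zero *)

Lemma intr_neq0 (K : fieldType) (charK : [pchar K] =i pred0) (z : int) :
  z != 0 -> z%:~R != 0 :> K.
Proof.
case: z => m m0; rewrite ?NegzE ?mulrNz ?oppr_eq0 -pmulrn ((pcharf0P K).1 charK) //.
Qed.

Lemma rat_morphism (K : fieldType) (charK : [pchar K] =i pred0) :
  exists f : {rmorphism rat -> K}, True.
Proof.
have den0 q : (denq q)%:~R != 0 :> K by rewrite intr_neq0 ?denq_neq0.
have key (q : rat) (a b : int) : b != 0 -> q = a%:~R / b%:~R ->
    ratr q = a%:~R / b%:~R :> K.
  move=> b0 Dq; apply/eqP; rewrite eqr_div ?intr_neq0 // -!intrM.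
  have : q * b%:~R = a%:~R by rewrite Dq divfK // intr_eq0.
  rewrite -{1}(divq_num_den q) => /(congr1 ( *%R^~ (denq q)%:~R)).
  rewrite mulrAC divfK ?intr_eq0 ?denq_neq0 // -!intrM => /eqP.
  by rewrite eqr_int => /eqP->.
have frac q : (numq q)%:~R / (denq q)%:~R = q by apply: divq_num_den.
have addf : zmod_morphism (@ratr K).
  move=> x y.
  rewrite (key (x - y) (numq x * denq y - numq y * denq x) (denq x * denq y)).
  - by rewrite /ratr !(rmorphB, rmorphM) /=; field; rewrite !den0.
  - by rewrite mulf_neq0 ?denq_neq0.
  rewrite -{1}(frac x) -{1}(frac y) !(rmorphB, rmorphM) /=.
  by field; rewrite !intr_eq0 !denq_neq0.
have mulf : monoid_morphism (@ratr K).
  split; first by rewrite (key _ 1 1) ?divr1.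
  move=> x y; rewrite (key (x * y) (numq x * numq y) (denq x * denq y)).
  - by rewrite /ratr !rmorphM /=; field; rewrite !den0.
  - by rewrite mulf_neq0 ?denq_neq0.
  rewrite -{1}(frac x) -{1}(frac y) !rmorphM /=.
  by field; rewrite !intr_eq0 !denq_neq0.
pose h1 := GRing.isZmodMorphism.Build rat K (@ratr K) addf.
pose h2 := GRing.isMonoidMorphism.Build rat K (@ratr K) mulf.
pose f : {rmorphism rat -> K} := HB.pack (@ratr K) h1 h2.
by exists f.
Qed.

Lemma exists_nat_nonroot (R : idomainType) (q : {poly R}) :
  injective (fun m : nat => m%:R : R) -> q != 0 -> exists m : nat, q.[m%:R] != 0.
Proof.
move=> natr_inj q0; apply: contrapT => none.
pose rs := [seq m%:R : R | m <- iota 0 (size q)].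
suff: (size rs < size q)%N by rewrite size_map size_iota ltnn.
apply: max_poly_roots q0 _ _; last by rewrite map_inj_uniq ?iota_uniq.
apply/allP => _ /mapP[m _ ->]; apply/rootP/eqP; apply: contrapT => /negP qm.
by apply: none; exists m.
Qed.

(** * Specialization to a number field *)

(** The conclusion of the Nullstellensatz for the prime ideal [ker phi]: the
    algebraic points of its zero set, seen as morphisms [psi], are dense. *)
Definition specializable (R : comNzRingType) (K : fieldType)
    (phi : {rmorphism R -> K}) : Prop :=
  forall b, phi b != 0 -> exists2 psi : {rmorphism R -> algC},
    forall r, phi r = 0 -> psi r = 0 & psi b != 0.

Lemma map_poly_ker (R : comNzRingType) (K L : fieldType)
    (phi : {rmorphism R -> K}) (psi : {rmorphism R -> L}) (p : {poly R}) :
  (forall r, phi r = 0 -> psi r = 0) -> map_poly phi p = 0 ->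
  map_poly psi p = 0.
Proof.
move=> ker /polyP p0; apply/polyP => i; rewrite coef_map coef0 /=; apply: ker.
by have := p0 i; rewrite coef_map coef0.
Qed.

(** Dropping top coefficients that [phi] kills makes the leading coefficient
    nonzero in [K], so that pseudo-division becomes division over [K]. *)
Lemma truncate_lift (R : comNzRingType) (K : fieldType)
    (phi : {rmorphism R -> K}) (p : {poly R}) :
  map_poly phi p != 0 -> exists q, [/\ map_poly phi q = map_poly phi p,
    phi (lead_coef q) != 0 & size q = size (map_poly phi p)].
Proof.
set k := size (map_poly phi p) => nzp; exists (\poly_(i < k) p`_i).
have Eq : map_poly phi (\poly_(i < k) p`_i) = map_poly phi p.
  apply/polyP => i; rewrite !coef_map coef_poly; case: ifP => //.
  move/negbT; rewrite -leqNgt => /(nth_default 0) E.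
  by rewrite /= rmorph0 -[LHS]E coef_map.
have lk : phi p`_k.-1 != 0 by rewrite -coef_map -lead_coefE lead_coef_eq0.
have sq : size (\poly_(i < k) p`_i) = k.
  by rewrite size_poly_eq //; apply: contraNneq lk => ->; rewrite rmorph0.
split=> //; rewrite lead_coefE sq coef_poly.
by rewrite ltn_predL size_poly_gt0 nzp.
Qed.

(** Adjoining one element [x].  If [x] is transcendental over the image of [R],
    any value avoiding the roots of one polynomial will do.  Otherwise let [G] be
    a relation of least degree: pseudo-division by [G] shows that a root of the
    specialized [G] is a legitimate value for [x] once the leading coefficient
    of [G] stays nonzero, and a Bezout relation between [B] and [G] keeps [B]
    nonzero at that root. *)
Lemma specializable_poly (R : comNzRingType) (K : fieldType)
    (phi0 : {rmorphism R -> K}) (phi : {rmorphism {poly R} -> K}) :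
  (forall r, phi r%:P = phi0 r) -> specializable phi0 -> specializable phi.
Proof.
move=> phiC spec0 B; pose x := phi 'X.
have phiE p : phi p = (map_poly phi0 p).[x].
  rewrite -{1}[p]coefK poly_def rmorph_sum.
  rewrite (horner_coef_wide _ (size_poly _ _)) /=.
  by apply: eq_bigr => i _; rewrite -mul_polyC rmorphM rmorphXn coef_map phiC.
move=> B0.
have eval (psi0 : {rmorphism R -> algC}) z :
    exists psi : {rmorphism {poly R} -> algC},
      forall p, psi p = (map_poly psi0 p).[z].
  by exists (horner_eval z \o map_poly psi0).
have szm (p : {poly R}) : (size (map_poly phi0 p) <= size p)%N.
  exact: size_poly.
have phi_eq p q : map_poly phi0 p = map_poly phi0 q -> phi p = phi q.
  by rewrite !phiE => ->.
have BX0 : map_poly phi0 B != 0.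
  by apply: contraNneq B0 => E; rewrite phiE E horner0.
have [[G1 [G10 nzG1]]|transc] :=
    pselect (exists G, phi G = 0 /\ map_poly phi0 G != 0); last first.
  have lB : phi0 B`_(size (map_poly phi0 B)).-1 != 0.
    by rewrite -coef_map -lead_coefE lead_coef_eq0.
  have [psi0 ker0 psi0B] := spec0 _ lB.
  have [z Bz] : exists z, (map_poly psi0 B).[z] != 0.
    have [||m] := @exists_nat_nonroot _ (map_poly psi0 B); last by exists m%:R.
      by move=> i k /eqP; rewrite Num.Theory.eqr_nat => /eqP.
    by apply: contraNneq psi0B => E; rewrite -coef_map E coef0.
  have [psi psiE] := eval psi0 z; exists psi; rewrite ?psiE // => r r0.
  rewrite psiE (map_poly_ker ker0) ?horner0 //; apply: contrapT => nz.
  by apply: transc; exists r; split=> //; apply/eqP.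
have exP : exists k, `[< exists G : {poly R}, [/\ phi G = 0,
    phi0 (lead_coef G) != 0, size (map_poly phi0 G) = k & size G = k] >].
  have [G [EG lG sG]] := truncate_lift nzG1.
  exists (size (map_poly phi0 G1)); apply/asboolP; exists G.
  by split=> //; rewrite ?EG // (phi_eq _ _ EG).
case: (ex_minnP exP) => k /asboolP[G [G0 lG smG sG]] minG.
have minP p : phi p = 0 -> (size (map_poly phi0 p) < k)%N ->
    map_poly phi0 p = 0.
  move=> p0 szp; apply/eqP; apply: contraTT szp => nzp.
  have [q [Eq lq sq]] := truncate_lift nzp.
  rewrite -leqNgt; apply: minG; apply/asboolP; exists q.
  by split=> //; rewrite ?Eq // (phi_eq _ _ Eq).
have divide D p : phi0 (lead_coef D) != 0 -> exists t Q r,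
    (lead_coef D ^+ t) *: p = Q * D + r /\ (size r < size D)%N.
  move=> lD; have nzD : D != 0.
    by apply: contraNneq lD => ->; rewrite lead_coef0 rmorph0.
  exists (Pdiv.Ring.rscalp p D), (Pdiv.Ring.rdivp p D), (Pdiv.Ring.rmodp p D).
  by rewrite Pdiv.ComRing.rdivp_eq Pdiv.Ring.ltn_rmodp nzD.
(* Bezout without a fraction field: [D] is a combination of [B] and [G] of
   least degree, which is then shown to be constant. *)
have exD : exists j, `[< exists U V D : {poly R},
    [/\ map_poly phi0 D = map_poly phi0 (U * B + V * G),
        phi0 (lead_coef D) != 0, size (map_poly phi0 D) = j & size D = j] >].
  exists k; apply/asboolP; exists 0, 1, G.
  by rewrite mul0r add0r mul1r.
case: (ex_minnP exD) => j /asboolP[U [V [D [ED lD smD sD]]]] minD.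
have exact_div U1 V1 : exists t Q,
    (phi0 (lead_coef D) ^+ t)%:P * map_poly phi0 (U1 * B + V1 * G) =
    map_poly phi0 Q * map_poly phi0 D.
  have [t [Q [r [E szr]]]] := divide D (U1 * B + V1 * G) lD.
  exists t, Q; have r0 : map_poly phi0 r = 0.
    apply/eqP; apply: contraTT szr => nzr.
    have [q [Eq lq sq]] := truncate_lift nzr.
    rewrite -leqNgt sD; apply: leq_trans (szm r); rewrite -sq.
    apply: minD; apply/asboolP.
    exists ((lead_coef D ^+ t) *: U1 - Q * U).
    exists ((lead_coef D ^+ t) *: V1 - Q * V), q.
    split; rewrite ?Eq //.
    have -> : r = (lead_coef D ^+ t) *: (U1 * B + V1 * G) - Q * D.
      by rewrite E addrC addKr.
    rewrite rmorphB /= (rmorphM _ Q D) /= ED -rmorphM -rmorphB /=.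
    congr map_poly; rewrite -!mul_polyC; ring.
  have := congr1 (map_poly phi0) E.
  rewrite rmorphD /= r0 addr0 (rmorphM _ Q D) /= => <-.
  by rewrite -mul_polyC (rmorphM _ (_ ^+ t)%:P) /= map_polyC /= rmorphXn.
have lDt t : phi0 (lead_coef D) ^+ t != 0 by rewrite expf_neq0.
(* [D] divides a multiple of [B], which does not vanish at [x]. *)
have phiD : phi D != 0.
  have [t [Q E]] := exact_div 1 0.
  apply: contraNneq B0 => D0; move: (congr1 (horner^~ x) E).
  rewrite mul1r mul0r addr0 !hornerM -!phiE D0 mulr0 hornerC => /eqP.
  by rewrite mulf_eq0 (negPf (lDt t)).
have nzD : map_poly phi0 D != 0.
  by apply: contraNneq phiD => E; rewrite phiE E horner0.
(* [D] also divides a multiple of [G]; were it not constant, the cofactor would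
   be a relation for [x] of smaller degree than [G]. *)
have j1 : j = 1%N.
  have j0 : (0 < j)%N by rewrite -smD size_poly_gt0 nzD.
  apply/eqP; rewrite eqn_leq j0 andbT leqNgt; apply/negP => j2.
  have [t [Q E]] := exact_div 0 1; rewrite mul0r mul1r add0r in E.
  have nzG : map_poly phi0 G != 0 by rewrite -size_poly_gt0 smG -sG;
    rewrite size_poly_gt0; apply: contraNneq lG => ->; rewrite lead_coef0 rmorph0.
  have nzQ : map_poly phi0 Q != 0.
    apply/eqP => Q0; move: E; rewrite Q0 mul0r => /eqP.
    by rewrite mulf_eq0 polyC_eq0 (negPf (lDt t)) (negPf nzG).
  have Q0 : phi Q = 0.
    move: (congr1 (horner^~ x) E); rewrite !hornerM -!phiE G0 mulr0 => /esym/eqP.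
    by rewrite mulf_eq0 (negPf phiD) orbF => /eqP.
  case/eqP: nzQ; apply: minP => //.
  have := congr1 (size \o polyseq) E; rewrite /= size_Cmul // size_mul ?nzQ //.
    by rewrite smG smD => ->; case: (j) j2 => [|[|i]] // _; rewrite !addnS ltnS leq_addr.
  by apply: contraTneq j2 => Q0'; case/eqP: (lDt t); move: E; rewrite Q0' mul0r => /eqP;
    rewrite mulf_eq0 polyC_eq0 (negPf (lDt t)) (negPf nzG).
pose c := D`_0; have Dc : D = c%:P by apply: size1_polyC; rewrite sD j1.
have lDc : lead_coef D = c by rewrite Dc lead_coefC.
have gc0 : phi0 (lead_coef G * c) != 0 by rewrite rmorphM mulf_neq0 // -lDc.
have [psi0 ker0] := spec0 _ gc0.
rewrite rmorphM mulf_eq0 negb_or => /andP[g0 pc0].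
have EUV : map_poly psi0 (U * B + V * G) = (psi0 c)%:P.
  apply/eqP; rewrite -subr_eq0 -map_polyC -Dc -rmorphB; apply/eqP.
  by apply: map_poly_ker ker0 _; rewrite rmorphB /= ED subrr.
have k2 : (1 < size G)%N.
  rewrite ltnNge; apply/negP => /size1_polyC E.
  case/negP: lG; rewrite E lead_coefC; apply/eqP.
  by rewrite -phiC -E.
have [z Gz] : exists z, root (map_poly psi0 G) z.
  apply: closed_rootP; rewrite size_map_poly_id0 //.
  by case: (size G) k2 => [|[]].
have {}Gz := rootP Gz; have [psi psiE] := eval psi0 z; exists psi.
  move=> r r0; have [t [Q [s [E szs]]]] := divide _ r lG.
  have s0 : map_poly phi0 s = 0.
    apply: minP.
      have -> : s = (lead_coef G ^+ t) *: r - Q * G by rewrite E addrC addKr.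
      by rewrite -mul_polyC rmorphB !rmorphM r0 G0 !mulr0 subrr.
    by rewrite -sG (leq_ltn_trans (szm s)).
  have := congr1 psi E; rewrite -mul_polyC !(rmorphM, rmorphD) /=.
  rewrite [psi G]psiE Gz mulr0 add0r [psi s]psiE (map_poly_ker ker0 s0).
  rewrite horner0 psiE map_polyC hornerC /= rmorphXn => /eqP.
  by rewrite mulf_eq0 expf_eq0 (negPf g0) andbF => /eqP.
apply: contraNneq pc0 => Bz; have := congr1 (horner^~ z) EUV.
rewrite hornerC rmorphD !rmorphM /= hornerD !hornerM Gz.
by rewrite -[(map_poly psi0 B).[z]]psiE Bz !mulr0 addr0 => <-.
Qed.
Definition ring_generated (R : comNzRingType) (iota : {rmorphism rat -> R})
    (gens : seq R) : Prop :=
  forall S : R -> Prop, (forall q, S (iota q)) -> (forall g, g \in gens -> S g) ->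
    (forall x y, S x -> S y -> S (x + y)) ->
    (forall x y, S x -> S y -> S (x * y)) -> forall x, S x.

(** [R] is an iterated polynomial ring over the rationals with one variable for
    each entry of [c]. *)
Lemma specialization_ring (K : fieldType) (charK : [pchar K] =i pred0)
    (c : seq K) :
  exists (R : comNzRingType) (phi : {rmorphism R -> K})
    (iota : {rmorphism rat -> R}) (gens : seq R),
  [/\ specializable phi, forall x, x \in c -> exists r, phi r = x
    & ring_generated iota gens].
Proof.
elim: c => [|x c [R [phi [iota [gens [spec im gen]]]]]].
  have [phi _] := rat_morphism charK; exists rat, phi, idfun, [::].
  split=> // [b b0|S Sq _ _ _ x]; last exact: Sq.
  exists (ratr : {rmorphism rat -> algC}).
    by move=> r /eqP; rewrite fmorph_eq0 => /eqP->; rewrite rmorph0.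
  by rewrite fmorph_eq0; apply: contraNneq b0 => ->; rewrite rmorph0.
have cfu : commr_rmorph phi x by move=> r; apply: mulrC.
exists {poly R}, (horner_morph cfu), (polyC \o iota), ('X :: map polyC gens).
have phiC r : horner_morph cfu r%:P = phi r by rewrite /= horner_morphC.
split; first exact: specializable_poly phiC spec.
  move=> y; rewrite inE => /predU1P[->|/im[r <-]].
    by exists 'X; rewrite /= horner_morphX.
  by exists r%:P; apply: phiC.
move=> S Sq Sg SD SM.
have SC r : S r%:P.
  move: r; apply: gen => [q|g gg|a b Sa Sb|a b Sa Sb].
  - exact: Sq.
  - by apply: Sg; rewrite inE map_f ?orbT.
  - by rewrite polyCD; apply: SD.
  - by rewrite polyCM; apply: SM.
apply: poly_ind => [|p r Sp]; first exact: (SC 0).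
by apply: SD => //; apply: SM => //; apply: Sg; rewrite inE eqxx.
Qed.

(** As [R] is finitely generated, its image in the algebraic numbers lies in a
    number field, which can be taken to contain the finite set [s] as well. *)
Lemma number_field_factor (R : comNzRingType) (iota : {rmorphism rat -> R})
    (gens : seq R) (psiC : {rmorphism R -> algC}) (s : seq algC) :
  ring_generated iota gens ->
  exists (L : fieldExtType rat) (j : {rmorphism L -> algC})
      (psi : {rmorphism R -> L}),
    [/\ forall r, j (psi r) = psiC r,
        forall x, x \in s -> exists y, j y = x
      & exists th : L, <<1; th>>%VS = fullv].
Proof.
move=> gen; have [z _ [ps Ds]] := algC_PET (s ++ map psiC gens).
have [L [j [[|th []] // [Dz] genL]]] := num_field_exists [:: z].
have jQ q : j (in_alg L q) = ratr q by rewrite -(fmorph_eq_rat (j \o in_alg L)).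
have im x : x \in s ++ map psiC gens -> exists y, j y = x.
  rewrite Ds => /mapP[p _ ->]; exists (map_poly (in_alg L) p).[th].
  rewrite -horner_map /= Dz -map_poly_comp; congr _.[_].
  by apply: eq_map_poly => q; apply: jQ.
have imR r : exists y, j y = psiC r.
  move: r; apply: gen => [q|g gg|a b [y Ey] [y' Ey']|a b [y Ey] [y' Ey']].
  - exists (in_alg L q); by rewrite jQ -(fmorph_eq_rat (psiC \o iota)).
  - by apply: im; rewrite mem_cat map_f ?orbT.
  - by exists (y + y'); rewrite !rmorphD /= Ey Ey'.
  - by exists (y * y'); rewrite !rmorphM /= Ey Ey'.
have [f fE] := choice imR.
have fB : zmod_morphism f.
  by move=> a b; apply: (fmorph_inj j); rewrite rmorphB !fE rmorphB.
have fM : monoid_morphism f.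
  split; first by apply: (fmorph_inj j); rewrite fE !rmorph1.
  by move=> a b; apply: (fmorph_inj j); rewrite rmorphM !fE rmorphM.
pose h1 := GRing.isZmodMorphism.Build R L f fB.
pose h2 := GRing.isMonoidMorphism.Build R L f fM.
pose psi : {rmorphism R -> L} := HB.pack f h1 h2.
exists L, j, psi; split=> //; last by exists th; rewrite -genL adjoin_seq1.
by move=> x xs; apply: im; rewrite mem_cat xs.
Qed.

Lemma num_field_intr_neq0 (L : fieldExtType rat) (k : int) :
  k != 0 -> k%:~R != 0 :> L.
Proof. by move=> k0; rewrite -(rmorph_int (in_alg L)) fmorph_eq0 intr_eq0. Qed.

Lemma polyOver_rat_scale (L : fieldExtType rat) (p : {poly L}) :
  p \is a polyOver 1%AS -> exists (g : {poly int}) (k : int),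
    k != 0 /\ k%:~R *: p = map_poly intr g.
Proof.
case/polyOver1P => q ->; have [g [k k0 ->]] := rat_poly_scale q.
exists g, k; split=> //; apply/polyP => i.
rewrite coefZ !coef_map coefZ coef_map /= -in_algE rmorphM fmorphV !rmorph_int.
by rewrite mulVKf // num_field_intr_neq0.
Qed.

Lemma primitive_int_poly (L : fieldExtType rat) (th : L) :
  <<1; th>>%VS = fullv -> forall x : L, exists (g : {poly int}) (k : int),
    k != 0 /\ x * k%:~R = (map_poly intr g).[th].
Proof.
move=> gen x; have : x \in <<1; th>>%VS by rewrite gen memvf.
case/Fadjoin_polyP => p /polyOver_rat_scale[g [k [k0 E]]] ->.
by exists g, k; rewrite -E hornerZ mulrC.
Qed.

Lemma algebraic_int_poly (L : fieldExtType rat) (th : L) :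
  exists h : {poly int}, h != 0 /\ (map_poly intr h).[th] = 0.
Proof.
have [h [k [k0 E]]] := polyOver_rat_scale (minPolyOver 1%AS th).
exists h; split; last by rewrite -E hornerZ minPolyxx mulr0.
apply: contraTneq (monic_neq0 (monic_minPoly 1%AS th)) => h0.
rewrite negbK; move/eqP: E; rewrite h0 rmorph0 -mul_polyC mulf_eq0 polyC_eq0.
by rewrite (negPf (num_field_intr_neq0 _ k0)).
Qed.
(** * Places of degree one of a number field *)

Lemma deriv_neq0 (R : numDomainType) (q : {poly R}) :
  (1 < size q)%N -> q^`() != 0.
Proof.
move=> szq; apply: contraTneq szq => /(congr1 (fun r : {poly R} => r`_(size q).-2)).
rewrite coef_deriv coef0; case E: (size q) => [|[|m]] //= /eqP.
by rewrite Num.Theory.mulrn_eq0 /= -[m.+1]/(m.+2.-1) -E -lead_coefE lead_coef_eq0 -size_poly_eq0 E.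
Qed.

Lemma horner_sub_dvd (h : {poly int}) (x y : int) : (y - x %| h.[y] - h.[x])%Z.
Proof.
have: root (h - h.[x]%:P) x by rewrite rootE !hornerE subrr.
case/factor_theorem => q E; have: (h - h.[x]%:P).[y] = (q * ('X - x%:P)).[y].
  by rewrite -E.
by rewrite !hornerE => ->; apply: dvdz_mull.
Qed.

(** Euclid's argument: if [c = h.[0]] is not 0, then [h.[c * B * k]] is [c] times
    an integer that is 1 modulo [B]; for a suitable [k] this integer is neither 1
    nor -1, and its prime divisors do not divide [B]. *)
Lemma prime_divides_value (h : {poly int}) (B : int) :
  (1 < size h)%N -> B != 0 -> exists (p : nat) (n : int),
    [/\ prime p, (p%:Z %| h.[n])%Z & ~~ (p%:Z %| B)%Z].
Proof.
move=> szh B0; have [[n hn]|noroot] := pselect (exists n : int, h.[n] = 0).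
  have [p ltp pp] := prime_above `|B|%N; exists p, n; rewrite hn dvdz0; split=> //.
  rewrite dvdzE absz_nat; apply: contraL ltp => /dvdn_leq.
  by rewrite absz_gt0 -leqNgt => ->.
pose c := h.[0]; have c0 : c != 0 by apply/eqP => E; apply: noroot; exists 0.
pose g := h \Po ((c * B)%:P * 'X).
have szX : size ((c * B)%:P * 'X : {poly int}) = 2%N.
  by rewrite size_Cmul ?mulf_neq0 // size_polyX.
have szg : size g = size h.
  by rewrite size_comp_poly2 // szX.
have g_nc d : g - d%:P != 0.
  rewrite subr_eq0; apply: contraTneq szh => gd.
  by rewrite -szg gd size_polyC -leqNgt leq_b1.
have [||k] := @exists_nat_nonroot _ ((g - c%:P) * (g - (- c)%:P)).
- by move=> i j /eqP; rewrite Num.Theory.eqr_nat => /eqP.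
- by rewrite mulf_neq0.
rewrite hornerM mulf_eq0 negb_or !hornerE /g horner_comp !hornerE.
set n := c * B * k%:R; rewrite !subr_eq0 => /andP[hn1 hn2].
have /dvdzP[t Et] := horner_sub_dvd h 0 n.
have hn : h.[n] = c * (1 + B * k%:R * t).
  by rewrite -[LHS](subrK c) Et /n; ring.
set u := 1 + B * k%:R * t in hn.
have u1 : (1 < `|u|)%N.
  have: u != 0.
    by apply: contra_not_neq noroot => u0; exists n; rewrite hn u0 mulr0.
  have: `|u|%N != 1%N.
    apply/eqP => E; have [Eu|Eu] : u = 1 \/ u = -1 by lia.
      by rewrite hn Eu mulr1 eqxx in hn1.
    by rewrite hn Eu mulrN1 eqxx in hn2.
  lia.
have pu : ((pdiv `|u|%N)%:Z %| u)%Z by rewrite dvdzE absz_nat pdiv_dvd.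
exists (pdiv `|u|%N), n; split; first exact: pdiv_prime.
  by rewrite hn; apply: dvdz_mull.
apply/negP => pB; have : ((pdiv `|u|%N)%:Z %| (1 : int)%R)%Z.
  have -> : 1 = u - B * k%:R * t by rewrite /u; ring.
  by rewrite rpredB //= -mulrA dvdz_mulr.
by rewrite dvdzE absz_nat dvdn1 gtn_eqF // prime_gt1 // pdiv_prime.
Qed.

(** A discrete valuation ring of [L] with uniformizer [p] and residue field the
    prime field, described by what the dynamics uses: every element of [L] is
    integral up to a power of [p], residues are represented by natural numbers,
    and an element divisible by all powers of [p] is 0.  The ideal generated by
    [p ^ N] is the set of the [x] with [x / p%:R ^+ N \in O]. *)
Record unramified_place (L : fieldType) (p : nat) (O : subringClosed L) :
    Prop := UnramifiedPlace {
  place_prime : prime p;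
  place_absorb : forall x, exists k, p%:R ^+ k * x \in O;
  place_residue : forall x, x \in O -> exists n : nat, (x - n%:R) / p%:R \in O;
  place_unit : forall x, x \in O -> x / p%:R \notin O -> x^-1 \in O;
  place_sep : forall x, (forall N, x / p%:R ^+ N \in O) -> x = 0
}.

(** Here [L] is the field of fractions of Z[th] and [h] a polynomial of least
    degree that vanishes at [th].  If [p] divides [h.[n]] but neither the leading
    coefficient of [h] nor [h^`().[n]], then [th] |-> [n] is a point of degree one
    and unramified above [p]; its local ring consists of the fractions
    [g(th) / e(th)] with [e.[n]] prime to [p]. *)
Section PrimitivePlace.
Variables (L : fieldType) (th : L) (h : {poly int}).
Hypothesis charL : forall k : int, k != 0 -> k%:~R != 0 :> L.
Hypothesis prim : forall x : L, exists (g : {poly int}) (k : int),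
  k != 0 /\ x * k%:~R = (map_poly intr g).[th].
Hypothesis h0 : h != 0.
Hypothesis h_th : (map_poly intr h).[th] = 0.
Hypothesis h_min : forall g : {poly int}, (map_poly intr g).[th] = 0 ->
  g != 0 -> (size h <= size g)%N.

Local Notation ev g := (map_poly intr g).[th].

Lemma evD g1 g2 : ev (g1 + g2) = ev g1 + ev g2.
Proof. by rewrite rmorphD hornerD. Qed.
Lemma evB g1 g2 : ev (g1 - g2) = ev g1 - ev g2.
Proof. by rewrite rmorphB hornerD hornerN. Qed.
Lemma evM g1 g2 : ev (g1 * g2) = ev g1 * ev g2.
Proof. by rewrite rmorphM hornerM. Qed.
Lemma evC (k : int) : ev k%:P = k%:~R.
Proof. by rewrite map_polyC hornerC. Qed.
Lemma evX : ev 'X = th.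
Proof. by rewrite map_polyX hornerX. Qed.

Variables (p : nat) (n : int).
Hypotheses (p_prime : prime p) (p_h : (p%:Z %| h.[n])%Z).
Hypothesis p_lead : ~~ (p%:Z %| lead_coef h)%Z.

Local Notation red g := (p%:Z %| g.[n])%Z.

Lemma prime_dvdzM (a b : int) :
  (p%:Z %| a * b)%Z = (p%:Z %| a)%Z || (p%:Z %| b)%Z.
Proof. by rewrite !dvdzE absz_nat abszM Euclid_dvdM. Qed.

(** Reduction at [n] is well defined: pseudo-division by [h] shows that a
    polynomial vanishing at [th] is a multiple of [h], up to a power of the
    leading coefficient of [h]. *)
Lemma ev0_red (g : {poly int}) : ev g = 0 -> red g.
Proof.
move=> g0; have E := Pdiv.ComRing.rdivp_eq h g.
set l := lead_coef h ^+ _ in E; set r := Pdiv.Ring.rmodp _ _ in E.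
have r0 : r = 0.
  apply: contraTeq (Pdiv.Ring.ltn_rmodpN0 g h0) => nzr; rewrite -leqNgt h_min //.
  have := congr1 (fun q => ev q) E.
  by rewrite -mul_polyC evD !evM g0 h_th !mulr0 add0r => <-.
have := congr1 (horner^~ n) E; rewrite r0 addr0 hornerZ hornerM => El.
have : (p%:Z %| l * g.[n])%Z by rewrite El dvdz_mull.
rewrite prime_dvdzM => /orP[pl|//]; case/negP: p_lead.
by move: pl; rewrite /l !dvdzE absz_nat abszX Euclid_dvdX // => /andP[].
Qed.

Lemma nred_ev_neq0 (g : {poly int}) : ~~ red g -> ev g != 0.
Proof. by apply: contraNneq => /ev0_red. Qed.

Definition place_pred : {pred L} := fun x =>
  `[< exists g e : {poly int}, ~~ red e /\ x * ev e = ev g >].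

Lemma red1 : ~~ red 1.
Proof. by rewrite hornerC dvdzE absz_nat dvdn1 gtn_eqF ?prime_gt1. Qed.

Lemma place_predP x : reflect
  (exists g e : {poly int}, ~~ red e /\ x * ev e = ev g) (x \in place_pred).
Proof. exact: asboolP. Qed.

Lemma redM g1 g2 : red (g1 * g2) = red g1 || red g2.
Proof. by rewrite hornerM prime_dvdzM. Qed.

Lemma place_subring : subring_closed place_pred.
Proof.
split; first by apply/place_predP; exists 1, 1; rewrite red1 mul1r.
  move=> x y /place_predP[g1 [e1 [re1 E1]]] /place_predP[g2 [e2 [re2 E2]]].
  apply/place_predP; exists (g1 * e2 - g2 * e1), (e1 * e2).
  rewrite redM negb_or re1; split=> //.
  by rewrite evB !evM -E1 -E2; ring.
move=> x y /place_predP[g1 [e1 [re1 E1]]] /place_predP[g2 [e2 [re2 E2]]].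
apply/place_predP; exists (g1 * g2), (e1 * e2).
by rewrite redM negb_or re1; split=> //; rewrite !evM -E1 -E2; ring.
Qed.

Lemma place_ring_exists : exists O : subringClosed L, forall x,
  x \in O <-> exists g e : {poly int}, ~~ red e /\ x * ev e = ev g.
Proof.
pose O : subringClosed L := HB.pack place_pred
  (GRing.isSubringClosed.Build L place_pred place_subring).
by exists O => x; split=> /place_predP.
Qed.

Variable O : subringClosed L.
Hypothesis OP : forall x,
  x \in O <-> exists g e : {poly int}, ~~ red e /\ x * ev e = ev g.

Lemma evW g : ev g \in O.
Proof. by apply/OP; exists g, 1; rewrite red1 evC mulr1. Qed.

Lemma ev_unit g : ~~ red g -> (ev g)^-1 \in O.
Proof.
move=> rg; apply/OP; exists 1, g.
by rewrite mulVf ?nred_ev_neq0 // evC.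
Qed.

Lemma prime_neq0 : p%:R != 0 :> L.
Proof. by rewrite [p%:R]pmulrn charL // -lt0n prime_gt0. Qed.

Hypothesis p_deriv : ~~ red h^`().

(** The maximal ideal is a priori generated by [p] and [th - n]; but writing [h = q * ('X - n) + h.[n]] gives
    [th - n = - h.[n] / q(th)], a multiple of [p], where [q(th)] is a unit because
    [q.[n] = h^`().[n]]. *)
Lemma red_ev g : red g -> ev g / p%:R \in O.
Proof.
have E (q : {poly int}) : exists q1, q = q1 * ('X - n%:P) + (q.[n])%:P.
  have: root (q - q.[n]%:P) n by rewrite rootE !hornerE subrr.
  by case/factor_theorem => q1 Eq; exists q1; rewrite -Eq subrK.
have th_n : (th - n%:~R) / p%:R \in O.
  have [q Eq] := E h; have [t Et] := dvdzP p_h.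
  have rq : ~~ red q.
    move: p_deriv; rewrite {1}Eq derivD derivC addr0 derivM derivXsubC !hornerE.
    by rewrite subrr mulr0 add0r.
  have := congr1 (fun q => ev q) Eq.
  rewrite h_th evD evM evB evX !evC Et rmorphM /= -[p%:~R]/(p%:R) => E0.
  have -> : (th - n%:~R) / p%:R = ev (- t%:P) / ev q.
    rewrite rmorphN hornerN evC; apply/eqP; rewrite eqr_div ?prime_neq0 ?nred_ev_neq0 //.
    rewrite -subr_eq0 [X in X == 0](_ : _ = 0) // E0; ring.
  by rewrite rpredM ?evW ?ev_unit.
move=> /dvdzP[t Et]; have [q Eq] := E g.
rewrite Eq evD evM evB evX !evC Et rmorphM /= -[p%:~R]/(p%:R).
rewrite mulrDl -mulrA mulfK ?prime_neq0 // rpredD ?rpred_int //.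
by rewrite rpredM ?evW.
Qed.

Lemma int_inv_mod (a b : int) : ~~ (p%:Z %| a)%Z ->
  exists r : nat, (p%:Z %| b - r%:Z * a)%Z.
Proof.
move=> pa; have cop : coprimez a p by rewrite coprimezE absz_nat coprime_sym
  prime_coprime // -(absz_nat p) -dvdzE.
have [u [v E]] := Bezoutz a p; have := cop; rewrite /coprimez => /eqP E1.
rewrite E1 in E; exists `|(b * u %% p%:Z)%Z|%N.
have p0 : p%:Z != 0 by rewrite -lt0n prime_gt0.
rewrite gez0_abs ?modz_ge0 //.
have -> : b - (b * u %% p)%Z * a = (b * v + (b * u %/ p)%Z * a) * p%:Z.
  have -> : (b * u %% p)%Z = b * u - (b * u %/ p)%Z * p%:Z.
    by rewrite {2}(divz_eq (b * u) p) addrC addKr.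
  rewrite -[X in X - _]mulr1 -[in LHS]E; ring.
exact: dvdz_mull.
Qed.

Lemma unramified_place_ring : unramified_place p O.
Proof.
have absorb (k : int) : k != 0 -> exists t (k' : int),
    k = k' * p%:Z ^+ t /\ ~~ (p%:Z %| k')%Z.
  move=> k0; have k_gt0 : (0 < `|k|)%N by rewrite absz_gt0.
  have [m cop E] := pfactor_coprime p_prime k_gt0.
  exists (logn p `|k|%N), ((-1) ^+ (k < 0)%R * m%:Z); split.
    by rewrite {1}[k]intEsign {1}E PoszM mulrA -[Posz (_ ^ _)]natz natrX natz.
  by rewrite dvdzE abszMsign !absz_nat -prime_coprime.
split=> //.
- move=> x; have [g [k [k0 E]]] := prim x; have [t [k' [Ek pk']]] := absorb k k0.
  exists t; apply/OP; exists g, k'%:P; rewrite hornerC; split=> //.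
  by rewrite -E evC Ek rmorphM rmorphXn /= -[p%:~R]/(p%:R); ring.
- move=> x /OP[g [e [re E]]].
  have [r Er] := int_inv_mod (g.[n]) re; exists r.
  have -> : (x - r%:R) / p%:R = (ev (g - r%:Z%:P * e) / p%:R) / ev e.
    rewrite evB evM evC -E -mulrBl -[r%:~R]/(r%:R) mulrAC mulfK ?nred_ev_neq0 //.
  by rewrite rpredM ?ev_unit // red_ev // !hornerE.
- move=> x /OP[g [e [re E]]] xp.
  have rg : ~~ red g.
    apply: contra xp => /red_ev gp.
    have -> : x / p%:R = (ev g / p%:R) / ev e.
      by rewrite -E mulrAC mulfK ?nred_ev_neq0.
    by rewrite rpredM ?ev_unit.
  apply/OP; exists e, g; split=> //; rewrite -E mulKf //.
  by apply: contraTneq (nred_ev_neq0 rg) => x0; rewrite -E x0 mul0r eqxx.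
move=> x xN; apply/eqP; apply: contraT => x0.
have [g [k [k0 E]]] := prim x^-1; have [t [k' [Ek pk']]] := absorb k k0.
have Ek' : k'%:~R * p%:R ^+ t = x * ev g.
  by rewrite -E mulVKf // Ek rmorphM rmorphXn.
have : k'%:~R / p%:R \in O.
  have -> : k'%:~R / p%:R = (x / p%:R ^+ t.+1) * ev g.
    rewrite mulrAC -Ek' exprSr invfM mulrA mulfK ?expf_neq0 ?prime_neq0 //.
  by rewrite rpredM ?evW.
case/OP => g' [e [re E']].
have : red (k'%:P * e - p%:Z%:P * g').
  apply: ev0_red; rewrite evB !evM !evC -E' -[p%:~R]/(p%:R) mulrA.
  by rewrite mulrCA divff ?prime_neq0 // mulr1 subrr.
rewrite !hornerE => pk; have: (p%:Z %| k' * e.[n])%Z.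
  by rewrite -(subrK (p%:Z * g'.[n]) (k' * _)) rpredD // dvdz_mulr.
by rewrite prime_dvdzM (negPf re) (negPf pk').
Qed.
End PrimitivePlace.

(** The primes to avoid are the divisors of the leading coefficient of [h], of
    a common denominator [D] of [s], of a denominator [k] of the inverse of
    [h'(th)], and those up to [B]. *)
Lemma unramified_place_exists (L : fieldExtType rat) (th : L) (s : seq L)
    (B : nat) : <<1; th>>%VS = fullv ->
  exists (p : nat) (O : subringClosed L),
    [/\ unramified_place p O, (B < p)%N & forall x, x \in s -> x \in O].
Proof.
move=> gen; have prim := primitive_int_poly gen.
have charL := @num_field_intr_neq0 L.
pose ev (g : {poly int}) := (map_poly intr g).[th].
have exh : exists m, `[< exists h, [/\ h != 0, ev h = 0 & size h = m] >].
  have [h [h0 hth]] := algebraic_int_poly th.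
  by exists (size h); apply/asboolP; exists h.
case: (ex_minnP exh) => m /asboolP[h [h0 hth szh]] min_m.
have h_min g : ev g = 0 -> g != 0 -> (size h <= size g)%N.
  by move=> g0 nzg; rewrite szh; apply: min_m; apply/asboolP; exists g.
have szh1 : (1 < size h)%N.
  rewrite ltnNge; apply/negP => /size1_polyC hC; move: hth h0; rewrite /ev hC.
  by rewrite map_polyC hornerC polyC_eq0 => Z /charL; rewrite Z eqxx.
have [D [D0 DP]] : exists D : int, D != 0 /\
    forall x, x \in s -> exists g, x * D%:~R = ev g.
  elim: s => [|x s [D [D0 IH]]]; first by exists 1; split.
  have [g [k [k0 E]]] := prim x; exists (D * k); split; first exact: mulf_neq0.
  move=> y; rewrite inE => /predU1P[->|/IH[g' E']].
    by exists (g * D%:P); rewrite /ev evM evC -E intrM; ring.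
  by exists (g' * k%:P); rewrite /ev evM evC -[_.[_]]E' intrM; ring.
have [u [k [k0 Ek]]] := prim (ev h^`())^-1.
have dh0 : ev h^`() != 0.
  apply/eqP => /h_min; rewrite leqNgt lt_size_deriv //.
  by rewrite deriv_neq0 // => /(_ isT).
have B0 : lead_coef h * D * k * (B`!)%:Z != 0.
  by rewrite !mulf_neq0 ?lead_coef_eq0 // -lt0n fact_gt0.
have [p [n [pp ph]]] := prime_divides_value szh1 B0.
rewrite !(prime_dvdzM pp) !negb_or -!andbA => /and4P[plead pD pk pB].
have pderiv : ~~ (p%:Z %| h^`().[n])%Z.
  apply: contra pk => pd; have : (p%:Z %| (k%:P - h^`() * u).[n])%Z.
    apply: (ev0_red h0 hth h_min pp ph plead).
    by rewrite evB evM evC -Ek mulVKf // subrr.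
  rewrite !hornerE => pk.
  by rewrite -(subrK (h^`().[n] * u.[n]) k) rpredD // dvdz_mulr.
have [O OP] := place_ring_exists th n pp.
exists p, O; split.
- exact: (unramified_place_ring charL prim h0 hth h_min pp ph plead OP pderiv).
- rewrite ltnNge; apply: contra pB => leB; rewrite dvdzE !absz_nat.
  by rewrite dvdn_fact // prime_gt0.
move=> x /DP[g E]; apply/OP; exists g, D%:P; rewrite hornerC.
by rewrite evC.
Qed.
(** * Sequences at a place *)

(** The sequences killed by the product of the operators (shift - g), for [g]
    in [G]. *)
Fixpoint linrec (R : pzRingType) (G : seq R) (c : nat -> R) : Prop :=
  if G is g :: G' then linrec G' (fun m => c m.+1 - g * c m)
  else forall m, c m = 0.

Section PlaceSequences.
Variables (L : fieldType) (p : nat) (O : subringClosed L).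
Hypothesis placeO : unramified_place p O.

Lemma place_p_neq0 : p%:R != 0 :> L.
Proof.
apply/negP => /eqP p0; have /eqP := oner_neq0 L; apply.
apply: (place_sep placeO) => [[|N]]; first by rewrite expr0 divr1 rpred1.
by rewrite p0 expr0n invr0 mulr0 rpred0.
Qed.

Local Notation "x =_ N y" := ((x - y) / p%:R ^+ N \in O)
  (at level 70, N at level 2).

Lemma place_pV : (p%:R^-1 : L) \notin O.
Proof.
apply/negP => pO; have /eqP := oner_neq0 L; apply.
by apply: (place_sep placeO) => N; rewrite mul1r -exprVn rpredX.
Qed.

Lemma pow_mem N x : x / p%:R ^+ N \in O -> x \in O.
Proof.
move=> xN; rewrite -(divfK (_ : p%:R ^+ N != 0) x) ?expf_neq0 ?place_p_neq0 //.
by rewrite rpredM // rpredX // rpred_nat.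
Qed.

Lemma pow_memS N x : x / p%:R ^+ N.+1 \in O -> x / p%:R ^+ N \in O.
Proof.
move=> xN; have -> : x / p%:R ^+ N = x / p%:R ^+ N.+1 * p%:R.
  by rewrite exprSr invfM mulrA divfK ?place_p_neq0.
by rewrite rpredM ?rpred_nat.
Qed.

Lemma pow_mem_le M N x : (N <= M)%N -> x / p%:R ^+ M \in O -> x / p%:R ^+ N \in O.
Proof.
move/subnK <-; elim: (M - N)%N => // k IH; rewrite addSn => /pow_memS; exact: IH.
Qed.

Lemma cong_refl N x : x =_N x.
Proof. by rewrite subrr mul0r rpred0. Qed.

Lemma cong_sym N x y : x =_N y -> y =_N x.
Proof. by move=> xy; rewrite -opprB mulNr rpredN. Qed.

Lemma cong_trans N x y z : x =_N y -> y =_N z -> x =_N z.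
Proof.
move=> xy yz; have -> : x - z = (x - y) + (y - z) by ring.
by rewrite mulrDl rpredD.
Qed.

Lemma congD N x y x' y' : x =_N y -> x' =_N y' -> x + x' =_N (y + y').
Proof.
by move=> xy xy'; rewrite opprD addrACA mulrDl rpredD.
Qed.

Lemma congM N x y x' y' : x' \in O -> y \in O ->
  x =_N y -> x' =_N y' -> x * x' =_N (y * y').
Proof.
move=> x'O yO xy xy'.
have -> : x * x' - y * y' = x' * (x - y) + y * (x' - y') by ring.
by rewrite mulrDl -!mulrA rpredD // rpredM.
Qed.

Lemma residue_pow N x : x \in O -> exists n : nat, x =_N n%:R.
Proof.
move=> xO; elim: N => [|N [n En]].
  by exists 0%N; rewrite subr0 expr0 divr1.
have [m Em] := place_residue placeO En; exists (n + m * p ^ N)%N.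
have -> : (x - (n + m * p ^ N)%:R) / p%:R ^+ N.+1 =
    ((x - n%:R) / p%:R ^+ N - m%:R) / p%:R; last by [].
rewrite natrD natrM natrX exprSr invfM mulrA; congr (_ / _).
by rewrite opprD addrA mulrBl mulfK // expf_neq0 ?place_p_neq0.
Qed.

Lemma residue_bounded N x : x \in O -> exists n : 'I_(p ^ N), x =_N n%:R.
Proof.
move=> /(residue_pow N)[n En].
have pN : (0 < p ^ N)%N by rewrite expn_gt0 prime_gt0 // (place_prime placeO).
exists (Ordinal (ltn_pmod n pN)); apply: cong_trans En _ => /=.
rewrite {1}(divn_eq n (p ^ N)) natrD addrK natrM natrX mulfK.
  by rewrite rpred_nat.
by rewrite expf_neq0 ?place_p_neq0.
Qed.

Lemma residue_pigeonhole N (x : nat -> L) : (forall m, x m \in O) ->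
  exists i j, (i < j)%N /\ x j =_N (x i).
Proof.
move=> xO; have [r rE] := choice (fun m => residue_bounded N (xO m)).
have [inj|] := pselect (injective (fun i : 'I_(p ^ N).+1 => r i)).
  by have := leq_card _ inj; rewrite !card_ord ltnn.
move=> ninj; have [i [j [ij E]]] : exists i j : nat, i != j /\ r i = r j.
  apply: contrapT => H; apply: ninj => i j E; apply: contrapT => ij.
  by apply: H; exists i, j; split=> //; apply/eqP => /val_inj.
have H (i' j' : nat) : r i' = r j' -> x j' =_N (x i').
  move=> E'; apply: cong_trans (rE j') _; rewrite -E'.
  exact: cong_sym (rE i').
by case: (ltngtP i j) ij => // ltij _; [exists i, j | exists j, i]; split=> //;
  apply: H.
Qed.

Definition periodic_mod N (x : nat -> L) :=
  exists T, (0 < T)%N /\ forall m, x (m + T)%N =_N (x m).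

Lemma periodic_modM N x T k : (forall m, x (m + T)%N =_N (x m)) ->
  forall m, x (m + k * T)%N =_N (x m).
Proof.
move=> per; elim: k => [|k IH] m; first by rewrite mul0n addn0 cong_refl.
by rewrite mulSn addnC -addnA [(k * T + m)%N]addnC addnC; apply: cong_trans (per _) (IH m).
Qed.

(** In a finite set of residues two terms of [x] agree; if congruences can be
    carried backwards, they can be carried back to the first term, so that there
    is no preperiod.  The step from [x m] to [x m.+1] may depend on [m] modulo
    [T], whence the sampling at multiples of [T]. *)
Lemma reversible_periodic N T (x : nat -> L) : (0 < T)%N ->
  (forall m, x m \in O) ->
  (forall m k, x (m + k * T)%N =_N (x m) <-> x (m + k * T).+1 =_N (x m.+1)) ->
  periodic_mod N x.
Proof.
move=> T0 xO rev.
have [i [j [ltij E]]] := residue_pigeonhole N (fun k => xO (k * T)%N).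
have E0 : x (0 + (j - i) * T)%N =_N (x 0%N).
  have : x (i * T + (j - i) * T)%N =_N (x (i * T)%N).
    by rewrite -mulnDl subnKC // ltnW.
  elim: (i * T)%N => // m IH; rewrite addSn => /rev; exact: IH.
exists ((j - i) * T)%N; rewrite muln_gt0 subn_gt0 ltij T0; split=> //.
by elim=> // m IH; rewrite addSn; apply/rev.
Qed.

(** Such a sequence comes back infinitely often to each of its values, as
    closely as desired. *)
Definition recurrent (x : nat -> L) :=
  (forall m, x m \in O) /\ forall N, periodic_mod N x.

Lemma recurrent_cst a : a \in O -> recurrent (fun=> a).
Proof. by move=> aO; split=> // N; exists 1%N; split=> // m; apply: cong_refl. Qed.

Lemma recurrent_op (op : L -> L -> L) x y :
  (forall a b, a \in O -> b \in O -> op a b \in O) ->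
  (forall N a a' b b', a \in O -> a' \in O -> b \in O -> b' \in O ->
     a =_N a' -> b =_N b' -> op a b =_N (op a' b')) ->
  recurrent x -> recurrent y -> recurrent (fun m => op (x m) (y m)).
Proof.
move=> opO opC [xO xP] [yO yP]; split=> [m|N]; first exact: opO.
have [T [T0 TP]] := xP N; have [U [U0 UP]] := yP N.
exists (U * T)%N; rewrite muln_gt0 T0 U0; split=> // m.
apply: opC => //; first exact: periodic_modM TP _.
by rewrite mulnC; apply: periodic_modM UP _.
Qed.

Lemma recurrentD x y : recurrent x -> recurrent y ->
  recurrent (fun m => x m + y m).
Proof.
apply: (@recurrent_op +%R) => [a b aO bO|N a a' b b' _ _ _ _]; first exact: rpredD.
exact: congD.
Qed.

Lemma recurrentM x y : recurrent x -> recurrent y ->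
  recurrent (fun m => x m * y m).
Proof.
apply: (@recurrent_op *%R) => [a b aO bO|N a a' b b' aO aO' bO bO']; first exact: rpredM.
exact: congM.
Qed.

Lemma recurrentX x k : recurrent x -> recurrent (fun m => x m ^+ k).
Proof.
move=> xr; elim: k => [|k IH]; first exact/recurrent_cst/rpred1.
have -> : (fun m => x m ^+ k.+1) = (fun m => x m * x m ^+ k).
  by apply: funext => m; rewrite exprS.
exact: recurrentM.
Qed.

Lemma recurrent_sum (I : eqType) (r : seq I) (P : pred I) (F : I -> nat -> L) :
  (forall i, i \in r -> P i -> recurrent (F i)) ->
  recurrent (fun m => \sum_(i <- r | P i) F i m).
Proof.
elim: r => [|i r IH] Fr.
  rewrite (_ : (fun m => _) = (fun=> 0)); first exact/recurrent_cst/rpred0.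
  by apply: funext => m; rewrite big_nil.
rewrite (_ : (fun m => _) =
  (fun m => (if P i then F i m else 0) + \sum_(i <- r | P i) F i m)).
  apply: recurrentD; last by apply: IH => k kr; apply: Fr; rewrite inE kr orbT.
  case Pi: (P i); first by apply: Fr; rewrite ?inE ?eqxx.
  exact/recurrent_cst/rpred0.
by apply: funext => m; rewrite big_cons; case: ifP; rewrite ?add0r.
Qed.

Lemma recurrent_prod (I : eqType) (r : seq I) (F : I -> nat -> L) :
  (forall i, i \in r -> recurrent (F i)) ->
  recurrent (fun m => \prod_(i <- r) F i m).
Proof.
elim: r => [|i r IH] Fr.
  rewrite (_ : (fun m => _) = (fun=> 1)); first exact/recurrent_cst/rpred1.
  by apply: funext => m; rewrite big_nil.
rewrite (_ : (fun m => _) = (fun m => F i m * \prod_(i <- r) F i m)).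
  apply: recurrentM; first by apply: Fr; rewrite inE eqxx.
  by apply: IH => k kr; apply: Fr; rewrite inE kr orbT.
by apply: funext => m; rewrite big_cons.
Qed.

Definition escaping (y : nat -> L) := forall N, exists M, forall m, (M <= m)%N ->
  y m != 0 /\ (y m)^-1 / p%:R ^+ N \in O.

(** Dividing the relation by [y m ^+ E] shows that [C E m] is divisible by
    [p ^ N] for all large [m]; by periodicity modulo [p ^ N] it then is for all
    [m]. *)
Lemma elimination_top (C : nat -> nat -> L) (y : nat -> L) (E : nat) :
  escaping y -> (forall e, recurrent (C e)) ->
  (forall m, \sum_(e < E.+1) C e m * y m ^+ e = 0) -> forall m, C E m = 0.
Proof.
move=> esc rec rel m0; apply: (place_sep placeO) => N.
have [M MP] := esc N; have [T [T0 TP]] := (rec E).2 N.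
pose m := (m0 + M * T)%N.
have leMm : (M <= m)%N by rewrite (leq_trans (leq_pmulr _ T0)) ?leq_addl.
suff : C E m / p%:R ^+ N \in O.
  have := periodic_modM M TP m0; rewrite -/m => per.
  have := cong_sym per; move=> {}per CE.
  by rewrite -(subrK (C E m) (C E m0)) mulrDl rpredD.
have [y0 yN] := MP m leMm; have := rel m; rewrite big_ord_recr /= => /eqP.
rewrite addrC addr_eq0 => /eqP; move/(canRL (mulfK (expf_neq0 E y0))) => ->.
rewrite mulNr mulNr rpredN mulr_suml mulr_suml rpred_sum // => e _.
have -> : y m ^+ E = y m ^+ e * y m ^+ (E - e) by rewrite -exprD subnKC // ltnW.
rewrite invfM mulrA mulfK ?expf_neq0 // -(exprVn (y m)).
have : (0 < E - e)%N by rewrite subn_gt0.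
case: (E - e)%N => // d _; rewrite exprSr !mulrA -mulrA.
rewrite rpredM //; rewrite rpredM //; first exact: (rec e).1.
rewrite rpredX //; exact: pow_mem yN.
Qed.

Lemma elimination (C : nat -> nat -> L) (y : nat -> L) (E : nat) :
  escaping y -> (forall e, recurrent (C e)) ->
  (forall m, \sum_(e < E) C e m * y m ^+ e = 0) ->
  forall e, (e < E)%N -> forall m, C e m = 0.
Proof.
move=> esc rec; elim: E => [|E IH] rel e //; rewrite ltnS leq_eqVlt.
have top := elimination_top esc rec rel.
case/predU1P => [->|] //; apply: IH => m.
by have := rel m; rewrite big_ord_recr /= top mul0r addr0.
Qed.

(** With [z = 1 / y] in the ideal of [p], [f.[y] * z ^+ d] is congruent to the
    leading coefficient, which is a unit; so 1 / f(y) is a unit times [z ^+ d]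
    with [d] at least 2, and the valuation of [z] increases at each step. *)
Lemma escaping_iterate (f : {poly L}) (a : L) :
  (2 < size f)%N -> f \is a polyOver O -> (lead_coef f)^-1 \in O ->
  a != 0 -> a^-1 / p%:R \in O -> escaping (fun m => iter m (horner f) a).
Proof.
move=> szf fO fl a0 ap; set y := fun m : nat => iter m (horner f) a.
have step m : y m != 0 /\ (y m)^-1 / p%:R ^+ m.+1 \in O.
  elim: m => [|m [y0 ym]]; first by rewrite expr1.
  set z := (y m)^-1 in ym; have z0 : z != 0 by rewrite invr_eq0.
  have zO : z \in O by apply: pow_mem ym.
  have zp : z / p%:R \in O by have := pow_mem_le (ltn0Sn m) ym; rewrite expr1.
  have [d Ed] : exists d, size f = d.+3.
    by case: (size f) szf => [|[|[|d]]] // _; exists d.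
  pose w := \sum_(i < d.+3) f`_i * z ^+ (d.+2 - i).
  have Ew : y m.+1 * z ^+ d.+2 = w.
    rewrite /y iterS -/(y m) horner_coef Ed mulr_suml; apply: eq_bigr => i _.
    have -> : z ^+ d.+2 = z ^+ i * z ^+ (d.+2 - i) by rewrite -exprD subnKC // -ltnS.
    by rewrite mulrA -[_ * _ * z ^+ i]mulrA -exprMn divff // expr1n mulr1.
  have fiO i : f`_i \in O by apply: (polyOverP fO).
  have wO : w \in O by rewrite rpred_sum // => i _; rewrite rpredM ?rpredX.
  have wp : w / p%:R \notin O.
    apply/negP; rewrite /w big_ord_recr /= subnn mulr1 mulrDl.
    rewrite rpredDl; last first.
      rewrite mulr_suml rpred_sum // => i _.
      rewrite subSn -1?ltnS // exprSr !mulrA -mulrA.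
      by rewrite rpredM // rpredM // rpredX.
    move=> lp; case/negP: place_pV.
    have -> : p%:R^-1 = (lead_coef f)^-1 * (f`_d.+2 / p%:R).
      rewrite mulrA lead_coefE Ed mulVf ?mul1r // -[d.+2]/(d.+3.-1) -Ed -lead_coefE.
      by rewrite lead_coef_eq0 -size_poly_eq0 Ed.
    by rewrite rpredM.
  have w0 : w != 0 by apply: contraNneq wp => ->; rewrite mul0r rpred0.
  have zd0 : z ^+ d.+2 != 0 by rewrite expf_neq0.
  have yS : y m.+1 = w / z ^+ d.+2 by rewrite -Ew mulfK.
  rewrite yS mulf_neq0 ?invr_eq0 //; split=> //.
  have -> : (w / z ^+ d.+2)^-1 / p%:R ^+ m.+2 =
     w^-1 * z ^+ d * (z / p%:R ^+ m.+1) * (z / p%:R).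
    rewrite invfM invrK [in LHS]exprSr [in LHS]exprSr [p%:R ^+ m.+2]exprSr invfM.
    ring.
  have wV := place_unit placeO wO wp.
  by do 2![apply: rpredM => //]; apply: rpredM => //; apply: rpredX.
move=> N; exists N => m leNm; have [y0 ym] := step m; split=> //.
exact: pow_mem_le (leqW leNm) ym.
Qed.


(** By induction on [f].  The last conjunct, that [f] respects congruences modulo
    [p], is what the induction needs; it also keeps the orbits near a fixed point
    in its residue disc. *)
Lemma horner_secant (f : {poly L}) (z x y : L) : f \is a polyOver O ->
  z \in O -> x \in O -> y \in O -> (x - z) / p%:R \in O -> (y - z) / p%:R \in O ->
  exists g, [/\ g \in O, f.[y] - f.[x] = (y - x) * g,
    (g - f^`().[z]) / p%:R \in O & (f.[x] - f.[z]) / p%:R \in O].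
Proof.
move=> fO zO xO yO xz yz; elim/poly_ind: f fO => [|f c IH] fO.
  by exists 0; rewrite rpred0 !horner0 deriv0 horner0 subrr mulr0 mul0r rpred0.
have {}fO : f \is a polyOver O.
  apply/polyOverP => i; have := polyOverP fO i.+1.
  by rewrite coefD coefMX coefC addr0.
have {IH} [g [gO E gd fxz]] := IH fO.
have [fx fz] : f.[x] \in O /\ f.[z] \in O by rewrite !rpred_horner.
exists (g * y + f.[x]); rewrite derivD derivC derivM derivX !hornerE; split.
- by rewrite rpredD ?rpredM.
- rewrite opprD addrACA subrr addr0.
  have -> : f.[y] = f.[x] + (y - x) * g by rewrite -E addrC subrK.
  ring.
- have -> : (g * y + f.[x] - (f^`().[z] * z + f.[z])) / p%:R =
    (g - f^`().[z]) / p%:R * z + g * ((y - z) / p%:R) + (f.[x] - f.[z]) / p%:R.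
    by field; apply: place_p_neq0.
  by rewrite !rpredD // rpredM.
have -> : (f.[x] * x + c - (f.[z] * z + c)) / p%:R =
    (f.[x] - f.[z]) / p%:R * x + f.[z] * ((x - z) / p%:R).
  by field; apply: place_p_neq0.
by rewrite rpredD // rpredM.
Qed.

Lemma unit_cong u v : u \in O -> v^-1 \in O -> v != 0 -> (u - v) / p%:R \in O ->
  u^-1 \in O /\ u != 0.
Proof.
move=> uO vV v0 uv; have up : u / p%:R \notin O.
  apply: contra place_pV => up.
  have -> : p%:R^-1 = v^-1 * (u / p%:R - (u - v) / p%:R).
    by field; rewrite v0 place_p_neq0.
  by rewrite rpredM // rpredB.
split; first exact: (place_unit placeO).
by apply: contraNneq up => ->; rewrite mul0r rpred0.
Qed.

(** On the residue disc of a fixed point whose multiplier is a unit, [f]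
    multiplies differences by units, so it is injective modulo every power of
    [p]. *)
Lemma recurrent_iterate (f : {poly L}) (z a : L) : f \is a polyOver O ->
  z \in O -> f.[z] = z -> f^`().[z] != 0 -> (f^`().[z])^-1 \in O ->
  (a - z) / p%:R \in O -> recurrent (fun m => iter m (horner f) a).
Proof.
move=> fO zO fz d0 dV az; set y := fun m : nat => iter m (horner f) a.
have near x : (x - z) / p%:R \in O -> x \in O.
  move=> xz; rewrite -(subrK z x) rpredD //.
  by apply: (@pow_mem 1); rewrite expr1.
have yz m : (y m - z) / p%:R \in O.
  elim: m => [//|m IH].
  have [g [_ _ _]] := horner_secant fO zO (near _ IH) (near _ IH) IH IH.
  by rewrite fz.
split=> [m|N]; first exact: near.
apply: (@reversible_periodic N 1%N) => // [m|m k]; first exact: near.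
set m' := (m + k * 1)%N; rewrite /y !iterS -!/(y _).
have [g [gO -> gd _]] := horner_secant fO zO (near _ (yz m)) (near _ (yz m'))
  (yz m) (yz m').
have [gV g0] := unit_cong gO dV d0 gd.
rewrite mulrAC; split=> [H|H]; first by rewrite rpredM.
by rewrite -(mulfK g0 (_ / _)) rpredM.
Qed.

Lemma recurrent_step (c d : nat -> L) (g : L) : g \in O -> g^-1 \in O -> g != 0 ->
  c 0%N \in O -> (forall m, c m.+1 = g * c m + d m) -> recurrent d -> recurrent c.
Proof.
move=> gO gV g0 c0 cS [dO dP]; have cO m : c m \in O.
  by elim: m => // m IH; rewrite cS rpredD ?rpredM.
split=> // N; have [T [T0 TP]] := dP N.
apply: (reversible_periodic T0) => // m k.
have dk := periodic_modM k TP m; rewrite !cS.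
have -> : (g * c (m + k * T)%N + d (m + k * T)%N - (g * c m + d m)) / p%:R ^+ N =
    g * ((c (m + k * T)%N - c m) / p%:R ^+ N) +
    (d (m + k * T)%N - d m) / p%:R ^+ N by ring.
rewrite rpredDr //; split=> H; first by rewrite rpredM.
by rewrite -(mulKf g0 (_ / _)) rpredM.
Qed.

Lemma linrec_recurrent (G : seq L) (c : nat -> L) :
  (forall g, g \in G -> [/\ g \in O, g^-1 \in O & g != 0]) -> linrec G c ->
  exists k, recurrent (fun m => p%:R ^+ k * c m).
Proof.
elim: G c => [|g G IH] c Gu /=.
  move=> c0; exists 0%N; rewrite (_ : (fun m => _) = (fun=> 0)).
    exact/recurrent_cst/rpred0.
  by apply: funext => m; rewrite c0 mulr0.
case/IH => [h hG|k1 rk1]; first by apply: Gu; rewrite inE hG orbT.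
have [k2 k2P] := place_absorb placeO (c 0%N); exists (k2 + k1)%N.
have [gO gV g0] := Gu g (mem_head _ _).
apply: (recurrent_step gO gV g0) => [|m|].
- by rewrite addnC exprD -mulrA rpredM // rpredX // rpred_nat.
- have -> : p%:R ^+ (k2 + k1) * c m.+1 = g * (p%:R ^+ (k2 + k1) * c m) +
     p%:R ^+ k2 * (p%:R ^+ k1 * (c m.+1 - g * c m)); last by [].
  by rewrite exprD; ring.
by apply: recurrentM => //; apply/recurrent_cst/rpredX/rpred_nat.
Qed.
End PlaceSequences.
(** The groups of indices in the conclusion are those with the same monomial in
    the [y j], for [j] in [js].  They are separated by one [y i] after the other:
    at the place of [i], where [y i] escapes and all other sequences are
    recurrent, [elimination] kills the coefficient of each power of [y i]. *)
Lemma linrec_separation (L : fieldType) (I : eqType) (js : seq I)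
    (y : I -> nat -> L) (p : I -> nat) (O : I -> subringClosed L) (G : seq L) :
  uniq js ->
  (forall i, i \in js -> unramified_place (p i) (O i)) ->
  (forall i, i \in js -> escaping (p i) (O i) (y i)) ->
  (forall i j, i \in js -> j \in js -> i != j -> recurrent (p i) (O i) (y j)) ->
  (forall i g, i \in js -> g \in G -> [/\ g \in O i, g^-1 \in O i & g != 0]) ->
  forall (T : eqType) (ex : T -> I -> nat) (U : seq T) (c : T -> nat -> L),
  (forall u, linrec G (c u)) ->
  (forall m, \sum_(u <- U) c u m * \prod_(j <- js) y j m ^+ ex u j = 0) ->
  forall u0 m, \sum_(u <- U | all (fun j => ex u j == ex u0 j) js) c u m = 0.
Proof.
elim: js => [|i js IH] uniq_js pl esc rec Gu T ex U c crec rel u0 m.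
  rewrite -[RHS](rel m); apply: eq_bigr => u _.
  by rewrite big_nil mulr1.
have iP : i \in i :: js by rewrite inE eqxx.
have jsP j : j \in js -> j \in i :: js by rewrite inE => ->; rewrite orbT.
move: uniq_js; rewrite cons_uniq => /andP[i_js uniq_js].
pose C e m := \sum_(u <- U | ex u i == e) c u m * \prod_(j <- js) y j m ^+ ex u j.
suff C0 e m' : C e m' = 0.
  rewrite /= -big_filter_cond; apply: (IH _ _ _ _ _ _ _ _ c) => //.
  - by move=> j /jsP; apply: pl.
  - by move=> j /jsP; apply: esc.
  - by move=> j k /jsP jP /jsP kP; apply: rec.
  - by move=> j g /jsP; apply: Gu.
  by move=> m'; rewrite big_filter; apply: C0.
have pli := pl _ iP.
have [kf kfP] := choice (fun u => linrec_recurrent pli (fun g => Gu i g iP) (crec u)).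
pose K := (\sum_(u <- U) kf u)%N.
have recC e0 : recurrent (p i) (O i) (fun m => (p i)%:R ^+ K * C e0 m).
  rewrite (_ : (fun m => _) = fun m => \sum_(u <- U | ex u i == e0)
      ((p i)%:R ^+ (K - kf u) * ((p i)%:R ^+ kf u * c u m) *
       \prod_(j <- js) y j m ^+ ex u j)); last first.
    apply: funext => k; rewrite mulr_sumr big_seq_cond [RHS]big_seq_cond.
    apply: eq_bigr => u /andP[uU _].
    have leK : (kf u <= K)%N by rewrite /K (big_rem u) //= leq_addr.
    by rewrite !mulrA -exprD subnK.
  apply: recurrent_sum => u uU _; apply: recurrentM.
    by apply: recurrentM => //; apply/recurrent_cst/rpredX/rpred_nat.
  apply: recurrent_prod => j jP; apply/recurrentX/rec => //; first exact: jsP.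
  by apply: contraNneq i_js => ->.
pose E := (\max_(u <- U) ex u i).+1.
have exE u : u \in U -> (ex u i < E)%N.
  by move=> uU; rewrite ltnS; apply: leq_bigmax_seq.
have relC k : \sum_(e < E) ((p i)%:R ^+ K * C e k) * y i k ^+ e = 0.
  transitivity ((p i)%:R ^+ K * \sum_(e < E) C e k * y i k ^+ e).
    by rewrite mulr_sumr; apply: eq_bigr => e' _; rewrite mulrA.
  suff -> : \sum_(e < E) C e k * y i k ^+ e =
      \sum_(u <- U) c u k * \prod_(j <- i :: js) y j k ^+ ex u j.
    by rewrite rel mulr0.
  under eq_bigr do rewrite mulr_suml big_mkcond.
  rewrite exchange_big /= big_seq [RHS]big_seq; apply: eq_bigr => u uU.
  rewrite (bigD1 (Ordinal (exE u uU))) //= eqxx [X in _ + X]big1 ?addr0 => [|e' ne].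
    by rewrite big_cons mulrAC mulrA.
  by case: eqP => // E'; case/eqP: ne; apply: val_inj.
have [lt|ge] := ltnP e E; last first.
  rewrite /C big_seq_cond big1 // => u /andP[uU /eqP eu].
  by have := exE u uU; rewrite eu ltnNge ge.
have := elimination pli (esc _ iP) recC relC lt m' => /eqP.
by rewrite mulf_eq0 expf_eq0 (negPf (place_p_neq0 pli)) andbF => /eqP.
Qed.
(** * From a number field back to the field of coefficients *)

Lemma finite_rank_witness (L : fieldType) (D : nat) (w : nat -> 'rV[L]_D) :
  (forall v : 'cV[L]_D, (forall m, w m *m v = 0) -> v = 0) ->
  exists M, row_full (\matrix_(i < M) w i).
Proof.
move=> indep; pose A M : 'M[L]_(M, D) := \matrix_(i < M) w i.
pose P r := `[< exists M, \rank (A M) = r >].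
have exP : exists r, P r by exists (\rank (A 0%N)); apply/asboolP; exists 0%N.
have ubP r : P r -> (r <= D)%N by case/asboolP => M <-; apply: rank_leq_col.
case: (ex_maxnP exP ubP) => r /asboolP[M rM] max_r.
exists M; rewrite -/(A M) /row_full; apply/negPn/negP => nfull.
have : kermx (A M)^T != 0.
  rewrite -mxrank_eq0 mxrank_ker mxrank_tr subn_eq0 -ltnNge ltn_neqAle nfull.
  exact: rank_leq_col.
case/rowV0Pn => v /sub_kermxP vA /eqP; apply.
have AMv : A M *m v^T = 0 by rewrite -[LHS]trmxK trmx_mul trmxK vA trmx0.
rewrite -[v]trmxK (indep v^T) ?trmx0 // => m.
pose M' := maxn M m.+1.
have sub : (A M <= A M')%MS.
  apply/row_subP => i; have ltiM' : (i < M')%N by rewrite (leq_trans (ltn_ord i)) ?leq_maxl.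
  by rewrite rowK -[w i](rowK (fun i : 'I_M' => w i) (Ordinal ltiM')) row_sub.
have /eqmxP eqA : (A M == A M')%MS.
  rewrite -(geq_leqif (mxrank_leqif_eq sub)) rM.
  by apply: max_r; apply/asboolP; exists M'.
have ltmM' : (m < M')%N by rewrite leq_maxr.
have : (w m <= A M)%MS.
  by rewrite eqA -[w m](rowK (fun i : 'I_M' => w i) (Ordinal ltmM')) row_sub.
by case/submxP => B ->; rewrite -mulmxA AMv mulmx0.
Qed.

(** Independence over [L] is witnessed by a nonzero minor of the infinite matrix
    of the [psi (w i m)]; the same minor is nonzero in [K], as [phi r = 0] implies
    [psi r = 0]. *)
Lemma independence_lift (R : comNzRingType) (K L : fieldType)
    (phi : {rmorphism R -> K}) (psi : {rmorphism R -> L})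
    (ker : forall r, phi r = 0 -> psi r = 0) (D : finType) (w : D -> nat -> R) :
  (forall v : D -> L, (forall m, \sum_i v i * psi (w i m) = 0) ->
     forall i, v i = 0) ->
  forall v : D -> K, (forall m, \sum_i v i * phi (w i m) = 0) ->
     forall i, v i = 0.
Proof.
move=> indep v rel.
pose r m : 'rV[R]_#|D| := \row_j w (enum_val j) m.
have [M full] : exists M, row_full (\matrix_(i < M) map_mx psi (r i)).
  apply: (finite_rank_witness (w := fun i => map_mx psi (r i))) => u relu.
  apply/colP => j; rewrite mxE.
  rewrite -(enum_valK j); move: (enum_val j).
  apply: (indep (fun d => u (enum_rank d) 0)) => m.
  have /matrixP/(_ 0 0) := relu m; rewrite !mxE => E; rewrite -[RHS]E.
  rewrite (reindex _ (onW_bij _ (enum_val_bij D))) /=.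
  by apply: eq_bigr => i _; rewrite enum_valK !mxE mulrC.
pose f := fullrankfun full.
pose W : 'M[R]_#|D| := \matrix_(i, j) r (f i) 0 j.
have detpsi : psi (\det W) != 0.
  have := fullrowsub_unit full; rewrite unitmxE unitfE -det_map_mx.
  by congr (\det _ != 0); apply/matrixP => i j; rewrite !mxE.
have detphi : map_mx phi W \in unitmx.
  rewrite unitmxE unitfE det_map_mx; apply: contraNneq detpsi => /ker ->.
  exact: eqxx.
pose u : 'cV[K]_#|D| := \col_j v (enum_val j).
have Wu : map_mx phi W *m u = 0.
  apply/colP => i; rewrite !mxE -[RHS](rel (f i)).
  rewrite [RHS](reindex _ (onW_bij _ (enum_val_bij D))) /=.
  by apply: eq_bigr => j _; rewrite !mxE mulrC.
have u0 : u = 0 by rewrite -(mulKmx detphi u) Wu mulmx0.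
by move=> i; have /colP/(_ (enum_rank i)) := u0; rewrite !mxE enum_rankK.
Qed.

Section LinearRecurrences.
Variable R : comNzRingType.
Implicit Types (G : seq R) (c : nat -> R).

(** The solution of [linrec G] that the first [j] operators (shift - g) turn into
    a geometric sequence, having applied each of them to a sequence that starts
    with 0.  Unlike the sequences [m ^ k * g ^ m], these remain a basis of the
    solutions when elements of [G] become equal under a specialization. *)
Fixpoint rec_basis G (j m : nat) : R :=
  match G, j with
  | [::], _ => 0
  | g :: _, 0%N => g ^+ m
  | g :: G', j'.+1 => \sum_(k < m) g ^+ (m - k.+1) * rec_basis G' j' k
  end.

Arguments rec_basis : simpl never.

Lemma rec_basis_head g G m : rec_basis (g :: G) 0 m = g ^+ m.
Proof. by []. Qed.

Lemma rec_basis_at0 g G j : rec_basis (g :: G) j.+1 0 = 0.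
Proof. by rewrite /rec_basis big_ord0. Qed.

Lemma rec_basisS g G j m :
  rec_basis (g :: G) j.+1 m.+1 - g * rec_basis (g :: G) j.+1 m = rec_basis G j m.
Proof.
rewrite /rec_basis -/rec_basis big_ord_recr /= subnn mul1r mulr_sumr addrAC -sumrB big1 ?add0r //.
move=> k _; rewrite subSn // exprS mulrA subrr //.
Qed.

Lemma eq_linrec G c c' : c =1 c' -> linrec G c -> linrec G c'.
Proof. by move=> /funext ->. Qed.

Lemma linrec0 G : linrec G (fun=> 0).
Proof.
elim: G => //= g G; apply: eq_linrec => m; by rewrite mulr0 subrr.
Qed.

Lemma linrec_lin G c c' a b : linrec G c -> linrec G c' ->
  linrec G (fun m => a * c m + b * c' m).
Proof.
elim: G c c' => [|g G IH] c c' /=.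
  by move=> c0 c0' m; rewrite c0 c0' !mulr0 addr0.
by move=> /IH h /h; apply: eq_linrec => m; ring.
Qed.

Lemma linrec_sum G (I : eqType) (r : seq I) (P : pred I) (F : I -> nat -> R) :
  (forall i, i \in r -> P i -> linrec G (F i)) ->
  linrec G (fun m => \sum_(i <- r | P i) F i m).
Proof.
elim: r => [|i r IH] FG.
  by apply: eq_linrec (linrec0 G) => m; rewrite big_nil.
have {}IH : linrec G (fun m => \sum_(i <- r | P i) F i m).
  by apply: IH => k kr; apply: FG; rewrite inE kr orbT.
case Pi: (P i); last by apply: eq_linrec IH => m; rewrite big_cons Pi.
have FGi := FG i (mem_head _ _) Pi.
by apply: eq_linrec (linrec_lin 1 1 FGi IH) => m; rewrite big_cons Pi !mul1r.
Qed.

Lemma linrec_basis G j : linrec G (rec_basis G j).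
Proof.
elim: G j => [|g G IH] [|j] //=.
  by apply: eq_linrec (linrec0 G) => m; rewrite !rec_basis_head exprS subrr.
by apply: eq_linrec (IH j) => m; rewrite -(rec_basisS g G j m).
Qed.

Lemma linrec_coords G c : linrec G c ->
  exists v : nat -> R, forall m, c m = \sum_(j < size G) v j * rec_basis G j m.
Proof.
elim: G c => [|g G IH] c /=.
  by move=> c0; exists (fun=> 0) => m; rewrite big_ord0.
case/IH => v vE; exists (fun j => if j is j'.+1 then v j' else c 0%N) => m.
elim: m => [|m IHm].
  rewrite big_ord_recl rec_basis_head mulr1 big1 ?addr0 // => j _.
  by rewrite rec_basis_at0 mulr0.
have stepS j : rec_basis (g :: G) j.+1 m.+1 =
    g * rec_basis (g :: G) j.+1 m + rec_basis G j m.
  by rewrite -[rec_basis G j m](rec_basisS g) addrC subrK.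
have := vE m; move/(canRL (subrK _)) => ->; rewrite IHm !big_ord_recl /= !rec_basis_head.
under [in RHS]eq_bigr => j _ do rewrite stepS mulrDr.
rewrite big_split /= exprS mulrDr mulr_sumr.
under [X in _ = _ + (X + _)]eq_bigr => j _ do rewrite mulrCA.
ring.
Qed.

Lemma rec_basis_free G (v : nat -> R) :
  (forall m, \sum_(j < size G) v j * rec_basis G j m = 0) ->
  forall j, (j < size G)%N -> v j = 0.
Proof.
elim: G v => [|g G IH] v rel //.
have v0 : v 0%N = 0.
  have := rel 0%N; rewrite big_ord_recl big1 ?addr0 /= ?mulr1 // => j _.
  by rewrite rec_basis_at0 mulr0.
case=> [|j] // ltj; apply: (IH (fun j => v j.+1)) => // m.
have sum0 k : \sum_(i < size G) v i.+1 * rec_basis (g :: G) i.+1 k = 0.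
  by rewrite -[RHS](rel k) big_ord_recl v0 mul0r add0r.
transitivity (\sum_(i < size G) v i.+1 * rec_basis (g :: G) i.+1 m.+1 -
    g * \sum_(i < size G) v i.+1 * rec_basis (g :: G) i.+1 m); last first.
  by rewrite !sum0 mulr0 subrr.
rewrite mulr_sumr -sumrB; apply: eq_bigr => i _.
by rewrite -[rec_basis G i m](rec_basisS g); ring.
Qed.
End LinearRecurrences.

Lemma rmorph_rec_basis (R S : comNzRingType) (f : {rmorphism R -> S}) G j m :
  f (rec_basis G j m) = rec_basis (map f G) j m.
Proof.
elim: G j m => [|g G IH] [|j] m; rewrite /rec_basis -/rec_basis /= ?rmorph0 ?rmorphXn //.
by rewrite rmorph_sum; apply: eq_bigr => k _; rewrite rmorphM rmorphXn IH.
Qed.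

(** A relation over [K] with coefficients solving the recurrence is a linear
    relation between the products of the [rec_basis] sequences and the monomials
    in the [Y j], all with values in [R]; [independence_lift] applies to it. *)
Lemma separation_lift (R : comNzRingType) (K L : fieldType)
    (phi : {rmorphism R -> K}) (psi : {rmorphism R -> L})
    (ker : forall r, phi r = 0 -> psi r = 0)
    (I : eqType) (js : seq I) (Y : I -> nat -> R) (G : seq R)
    (T : finType) (ex : T -> I -> nat) :
  (forall u v, (forall j, j \in js -> ex u j = ex v j) -> u = v) ->
  (forall c : T -> nat -> L, (forall u, linrec (map psi G) (c u)) ->
    (forall m, \sum_u c u m * \prod_(j <- js) psi (Y j m) ^+ ex u j = 0) ->
    forall u0 m, \sum_(u | all (fun j => ex u j == ex u0 j) js) c u m = 0) ->
  forall c : T -> nat -> K, (forall u, linrec (map phi G) (c u)) ->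
    (forall m, \sum_u c u m * \prod_(j <- js) phi (Y j m) ^+ ex u j = 0) ->
    forall u m, c u m = 0.
Proof.
move=> exI sepL c crec rel.
pose N := size G.
pose w (d : T * 'I_N) m := rec_basis G d.2 m * \prod_(j <- js) Y j m ^+ ex d.1 j.
have [v vE] := choice (fun u => linrec_coords (crec u)).
have sumw (F : fieldType) (f : {rmorphism R -> F}) (a : T -> nat -> F) m :
    \sum_(d : T * 'I_N) a d.1 d.2 * f (w d m) =
    \sum_u (\sum_(j < N) a u j * rec_basis (map f G) j m) *
       \prod_(j <- js) f (Y j m) ^+ ex u j.
  rewrite -(pair_bigA _ (fun u j => a u (j : 'I_N) * f (w (u, j) m))) /=.
  apply: eq_bigr => u _; rewrite mulr_suml; apply: eq_bigr => j _.
  rewrite /w rmorphM rmorph_rec_basis rmorph_prod mulrA.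
  by congr (_ * _); apply: eq_bigr => i _; rewrite rmorphXn.
have v0 : forall d : T * 'I_N, v d.1 d.2 = 0.
  apply: (independence_lift ker (w := w)) => [a ra d|m]; last first.
    rewrite sumw -[RHS](rel m); apply: eq_bigr => u _.
    by rewrite vE size_map.
  pose a' u k := if insub k is Some j then a (u, j) else 0.
  have a'E u (j : 'I_N) : a' u j = a (u, j) by rewrite /a' valK.
  have E m : \sum_u (\sum_(j < N) a' u j * rec_basis (map psi G) j m) *
       \prod_(j <- js) psi (Y j m) ^+ ex u j = 0.
    rewrite -sumw -[RHS](ra m); apply: eq_bigr => -[u j] _.
    by rewrite a'E.
  have rec u : linrec (map psi G)
      (fun m => \sum_(j < N) a' u j * rec_basis (map psi G) j m).
    apply: linrec_sum => j _ _.
    apply: eq_linrec (linrec_lin (a' u j) 0 (linrec_basis _ _) (linrec0 _)) => m.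
    by rewrite mulr0 addr0.
  have := sepL _ rec E d.1; case: d => u j /= sep.
  rewrite -a'E; apply: (rec_basis_free (G := map psi G)) => [m|]; last by rewrite size_map.
  rewrite size_map -[RHS](sep m) (big_pred1 u) // => u'.
  apply/allP/eqP => [H|-> i _]; last exact: eqxx.
  by apply: exI => i /H/eqP.
move=> u m; rewrite vE size_map big1 // => j _.
by rewrite (v0 (u, j)) mul0r.
Qed.
(** * Exponential polynomials *)

Section ExponentialPolynomials.
Variable K : fieldType.
Implicit Types (P : {poly K}) (g : K).

Let shift P : {poly K} := P \Po ('X + 1).

Lemma size_XD1 : size ('X + 1 : {poly K}) = 2.
Proof. by rewrite -['X + 1]/('X + 1%:P) size_XaddC. Qed.

Lemma size_shift P : size (shift P) = size P.
Proof. by rewrite size_comp_poly2 // size_XD1. Qed.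

Lemma lead_coef_shift P : lead_coef (shift P) = lead_coef P.
Proof.
rewrite lead_coef_comp ?size_XD1 // -['X + 1]/('X + 1%:P) lead_coefXaddC.
by rewrite expr1n mulr1.
Qed.

Lemma shift_nat P m : (shift P).[m%:R] = P.[m.+1%:R].
Proof. by rewrite horner_comp !hornerE natr1. Qed.

Lemma size_shift_sub P : (size (shift P - P)%R <= (size P).-1)%N.
Proof.
apply/leq_sizeP => j; rewrite coefB leq_eqVlt => /predU1P[<-|ltj].
  by rewrite -{1}size_shift -!lead_coefE lead_coef_shift subrr.
have lej : (size P <= j)%N by case: (size P) ltj.
by rewrite !nth_default ?size_shift // subrr.
Qed.

(** The operator (shift - h) on sequences [P.[m] * g ^+ m], read on [P]. *)
Definition twist (h g : K) P := g *: shift P - h *: P.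

Lemma twistE h g P m :
  P.[m.+1%:R] * g ^+ m.+1 - h * (P.[m%:R] * g ^+ m) =
  (twist h g P).[m%:R] * g ^+ m.
Proof. by rewrite /twist hornerD hornerN !hornerZ shift_nat exprS; ring. Qed.

Lemma size_twist h g P : (size (twist h g P) <= size P)%N.
Proof.
rewrite (leq_trans (size_polyD _ _)) // size_polyN geq_max.
by rewrite !(leq_trans (size_scale_leq _ _)) // size_shift.
Qed.

Lemma size_twist_eq g P : (size (twist g g P) <= (size P).-1)%N.
Proof.
rewrite /twist -scalerBr (leq_trans (size_scale_leq _ _)) //.
exact: size_shift_sub.
Qed.

Lemma twist_eq0 h g P : g != h -> twist h g P = 0 -> P = 0.
Proof.
move=> gh /(congr1 (fun q : {poly K} => q`_(size P).-1)).
rewrite coef0 coefB !coefZ -{1}size_shift -!lead_coefE lead_coef_shift -mulrBl.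
by move/eqP; rewrite mulf_eq0 subr_eq0 (negPf gh) lead_coef_eq0 => /eqP.
Qed.

Lemma exp_poly_linrec (G : seq K) g P : (size P <= count_mem g G)%N ->
  linrec G (fun m => P.[m%:R] * g ^+ m).
Proof.
elim: G P => [|h G IH] P /=.
  by rewrite leqn0 size_poly_eq0 => /eqP-> m; rewrite horner0 mul0r.
move=> szP; have : linrec G (fun m => (twist h g P).[m%:R] * g ^+ m).
  apply: IH; case: eqP szP => [->|_] szP; last first.
    exact: leq_trans (size_twist _ _ _) szP.
  by rewrite (leq_trans (size_twist_eq _ _)) // -subn1 leq_subLR.
by apply: eq_linrec => m; rewrite twistE.
Qed.

(** Applying (shift - h) lowers the degree of the coefficient of [h ^+ m] and
    keeps the others nonzero if they were; repeat until that coefficient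
    disappears. *)
Lemma exp_poly_free (charK : [pchar K] =i pred0) (G : seq K) :
  uniq G -> 0 \notin G -> forall P : K -> {poly K},
  (forall m, \sum_(g <- G) (P g).[m%:R] * g ^+ m = 0) ->
  forall g, g \in G -> P g = 0.
Proof.
elim: G => [|h G IH] //=; rewrite inE negb_or => /andP[hG uG] /andP[h0 G0] P.
have [d] := ubnP (size (P h)); elim: d => // d IHd in P *.
rewrite ltnS => szP rel.
have rel' m : \sum_(g <- h :: G) (twist h g (P g)).[m%:R] * g ^+ m = 0.
  under eq_bigr do rewrite -twistE.
  by rewrite sumrB -mulr_sumr !rel mulr0 subrr.
have [Ph0|Ph0] := eqVneq (P h) 0.
  move=> g; rewrite inE => /predU1P[->//|gG]; apply: IH gG => // m.
  by rewrite -[RHS](rel m) big_cons Ph0 horner0 mul0r add0r.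
have szPh : (0 < size (P h))%N by rewrite size_poly_gt0.
have tw0 : forall g, g \in h :: G -> twist h g (P g) = 0.
  apply: (IHd (fun g => twist h g (P g))) => //.
  by rewrite (leq_ltn_trans (size_twist_eq _ _)) // prednK.
have PG0 g : g \in G -> P g = 0.
  move=> gG; apply: (twist_eq0 (h := h) (g := g)).
    by apply: contraNneq hG => <-.
  by apply: tw0; rewrite inE gG orbT.
have Phm m : (P h).[m%:R] = 0.
  have := rel m; rewrite big_cons big_seq big1 ?addr0 => [/eqP|g gG]; last first.
    by rewrite PG0 // horner0 mul0r.
  by rewrite mulf_eq0 expf_eq0 (negPf (_ : h != 0)) 1?eq_sym // andbF orbF => /eqP.
have [|m] := @exists_nat_nonroot _ (P h) _ Ph0; last by rewrite Phm eqxx.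
move=> i j E; have [//|ij] := eqVneq i j.
have := intr_neq0 charK (_ : i%:Z - j%:Z != 0).
by rewrite intrB -!pmulrn E subrr eqxx subr_eq0 eqz_nat => /(_ ij).
Qed.
End ExponentialPolynomials.
(** * Starting points for the nonlinear coordinates *)

(** If every fixed point were critical, [F - 'X] would have derivative -1 at each
    of its roots, hence as many distinct roots as its degree, and all of them
    would be roots of the derivative of [F], which has smaller degree. *)
Lemma noncritical_fixed_point (F : {poly algC}) : (2 < size F)%N ->
  exists z, F.[z] = z /\ F^`().[z] != 0.
Proof.
move=> szF; apply: contrapT => none.
have crit z : F.[z] = z -> F^`().[z] = 0.
  by move=> Fz; apply: contrapT => /eqP dz; apply: none; exists z.
pose Q := F - 'X.
have szQ : size Q = size F by rewrite size_polyDl // size_polyN size_polyX.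
have Q0 : Q != 0 by rewrite -size_poly_gt0 szQ (ltn_trans _ szF).
have [rs Ers] := closed_field_poly_normal Q.
have rootQ z : root Q z -> F.[z] = z.
  by rewrite rootE hornerD hornerN hornerX subr_eq0 => /eqP.
have sep : separable_poly Q.
  rewrite separable_poly.unlock; apply: Pdiv.ClosedField.root_coprimep => z /rootQ /crit dz.
  by rewrite derivB derivX !hornerE dz sub0r oppr_eq0 oner_eq0.
have lQ0 : lead_coef Q != 0 by rewrite lead_coef_eq0.
have urs : uniq rs.
  move: sep; rewrite Ers.
  by rewrite (eqp_separable (eqp_scale _ lQ0)) separable_prod_XsubC.
have dF0 : F^`() != 0 by rewrite deriv_neq0 // (ltn_trans _ szF).
have : (size rs < size F^`())%N.
  apply: max_poly_roots dF0 _ urs; apply/allP => z zrs; apply/rootP/crit/rootQ.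
  by rewrite Ers rootZ // root_prod_XsubC.
rewrite ltnNge; case/negP; rewrite -ltnS.
have -> : (size rs).+1 = size F.
  by rewrite -szQ Ers size_scale // size_prod_XsubC.
by rewrite lt_size_deriv // -size_poly_gt0 (ltn_trans _ szF).
Qed.

Lemma chinese_seq (I : eqType) (s : seq I) (p r : I -> nat) : uniq s ->
  (forall i j, i \in s -> j \in s -> i != j -> coprime (p i) (p j)) ->
  exists N : nat, forall i, i \in s -> N = r i %[mod p i].
Proof.
elim: s => [|i s IH] /=; first by exists 0%N.
case/andP=> i_s us cop; have [|N NP] := IH us.
  by move=> j k js ks; apply: cop; rewrite inE ?js ?ks orbT.
have copi : coprime (p i) (\prod_(j <- s) p j).
  rewrite big_seq; apply: (big_ind (fun n => coprime (p i) n)).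
  - exact: coprimen1.
  - by move=> a b; rewrite coprimeMr => -> ->.
  - move=> j js; apply: cop; rewrite ?inE ?eqxx ?js ?orbT //.
    by apply: contraNneq i_s => ->.
exists (chinese (p i) (\prod_(j <- s) p j) (r i) N) => j.
rewrite inE => /predU1P[->|js]; first exact: chinese_modl.
have pj : (p j %| \prod_(j <- s) p j)%N.
  by rewrite (big_rem j) //= dvdn_mulr.
rewrite -(NP j js) -(modn_dvdm (chinese _ _ _ _) pj) chinese_modr //.
by rewrite modn_dvdm.
Qed.

Lemma place_nat_unit (L : fieldType) (p : nat) (O : subringClosed L) (m : nat) :
  unramified_place p O -> coprime m p -> m%:R^-1 \in O.
Proof.
move=> plO cop; have pp := place_prime plO.
apply: (place_unit plO); rewrite ?rpred_nat //.
apply: contra (place_pV plO) => mp.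
have [p0 m0] : p%:R != 0 :> L /\ (0 < m)%N.
  split; first exact: place_p_neq0 plO.
  by case: m cop {mp} => // /eqP; rewrite gcd0n => p1; rewrite p1 in pp.
case: (egcdnP p m0) => u v; rewrite (eqP cop) => E _.
have {}E : u%:R * m%:R = v%:R * p%:R + 1 :> L by rewrite -!natrM E natrD.
have -> : p%:R^-1 = u%:R * (m%:R / p%:R) - v%:R :> L.
  by rewrite mulrA E mulrDl mulfK // mul1r addrAC subrr add0r.
by apply: rpredB; rewrite ?rpred_nat //; apply: rpredM; rewrite ?rpred_nat.
Qed.

Lemma place_nat_cong (L : fieldType) (p : nat) (O : subringClosed L) (m n : nat) :
  unramified_place p O -> m = n %[mod p] -> (m%:R - n%:R) / p%:R \in O.
Proof.
move=> plO mn; have p0 : p%:R != 0 :> L by exact: place_p_neq0 plO.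
rewrite (divn_eq m p) (divn_eq n p) mn !natrD !natrM opprD addrACA subrr addr0.
by rewrite -mulrBl mulfK // rpredB ?rpred_nat.
Qed.

Lemma iter_rmorph (R S : comNzRingType) (f : {rmorphism R -> S}) (P : {poly R})
    x m : f (iter m (horner P) x) = iter m (horner (map_poly f P)) (f x).
Proof. by elim: m => //= m <-; rewrite horner_map. Qed.
Lemma place_sequence (L : fieldExtType rat) (th : L) (s : seq L) :
  <<1; th>>%VS = fullv ->
  exists (p : nat -> nat) (O : nat -> subringClosed L),
    [/\ forall k, unramified_place (p k) (O k), forall k x, x \in s -> x \in O k
      & forall k l, k != l -> coprime (p k) (p l)].
Proof.
move=> gen; pose PO := (nat * subringClosed L)%type.
have /choice[pl plP] : forall B, exists q : PO, [/\ unramified_place q.1 q.2,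
    (B < q.1)%N & forall x, x \in s -> x \in q.2].
  move=> B; have [p [O [plO ltB sO]]] := unramified_place_exists s B gen.
  by exists (p, O).
pose q := fix q k := if k is k'.+1 then (pl (q k')).1 else 0%N.
have ltq k l : (k < l)%N -> (q k < q l)%N.
  elim: l => // l IH; rewrite ltnS leq_eqVlt => /predU1P[->|/IH lt].
    by have [] := plP (q l).
  by apply: ltn_trans lt _; have [] := plP (q l).
exists (fun k => (pl (q k)).1), (fun k => (pl (q k)).2); split=> [k|k x xs|k l kl].
- by have [] := plP (q k).
- by have [_ _ sO] := plP (q k); apply: sO.
have pr k' : prime (pl (q k')).1 by have [/place_prime] := plP (q k').
rewrite prime_coprime // dvdn_prime2 // -[(pl (q k)).1]/(q k.+1).
rewrite -[(pl (q l)).1]/(q l.+1); move: kl; rewrite neq_ltn => /orP[lt|lt].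
  by rewrite ltn_eqF // ltq.
by rewrite gtn_eqF // ltq.
Qed.

(** By the Chinese remainder theorem: [N i] is 1 modulo [p i], and modulo each
    other [p j] it is [p i] times a representative of the residue of [z i]. *)
Lemma starting_points (L : fieldType) (I : finType) (p : I -> nat)
    (O : I -> subringClosed L) (z : I -> L) :
  (forall i, unramified_place (p i) (O i)) ->
  (forall i j, i != j -> coprime (p i) (p j)) ->
  (forall i j, z i \in O j) ->
  exists N : I -> nat, forall i, let a := (N i)%:R / (p i)%:R in
    [/\ a != 0, a^-1 / (p i)%:R \in O i
      & forall j, i != j -> (a - z i) / (p j)%:R \in O j].
Proof.
move=> plO cop zO.
have /choice[r rP] (d : I * I) : exists n : nat,
    (z d.1 - n%:R) / (p d.2)%:R \in O d.2.
  exact: place_residue (plO _) _ (zO _ _).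
have p0 i : (p i)%:R != 0 :> L by exact: place_p_neq0 (plO i).
have pr i := place_prime (plO i).
have /choice[N NP] i : exists N : nat, forall j,
    N = if i == j then 1 else (p i * r (i, j))%N %[mod p j].
  have [|N NP] := chinese_seq (fun j => if i == j then 1 else (p i * r (i, j)))%N
    (enum_uniq I) (p := p).
    by move=> j k _ _; apply: cop.
  by exists N => j; apply: NP; rewrite mem_enum.
exists N => i /=.
have copN : coprime (N i) (p i).
  by have := NP i i; rewrite eqxx => E; rewrite -coprime_modl E coprime_modl coprime1n.
have N0 : (N i)%:R != 0 :> L.
  have : (N i)%:R / (p i)%:R \notin O i.
    apply: contra (place_pV (plO i)) => NO.
    have -> : (p i)%:R^-1 = (N i)%:R / (p i)%:R - ((N i)%:R - 1%:R) / (p i)%:R :> L.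
      by rewrite -mulrBl opprB addrC subrK mul1r.
    rewrite rpredB //; apply: place_nat_cong (plO i) _.
    by have := NP i i; rewrite eqxx.
  by apply: contraNneq => ->; rewrite mul0r rpred0.
split; first by rewrite mulf_neq0 ?invr_eq0.
  by rewrite invfM invrK mulfK // (place_nat_unit (plO i)).
move=> j ij; have pV : (p i)%:R^-1 \in O j by rewrite (place_nat_unit (plO j)) ?cop.
have -> : ((N i)%:R / (p i)%:R - z i) / (p j)%:R =
   ((N i)%:R - (p i * r (i, j))%:R) / (p j)%:R / (p i)%:R
   - (z i - (r (i, j))%:R) / (p j)%:R.
  by rewrite natrM; field; rewrite !p0.
rewrite rpredB //; last exact: (rP (i, j)).
rewrite rpredM //; apply: place_nat_cong (plO j) _.
by have := NP i j; rewrite (negPf ij).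
Qed.

(** The starting points [a] are rational and depend neither on the recurrence [G]
    nor on the relation.  The elements of [us] are made invertible in [R], so that
    the products forming [G] become units at all the places. *)
Lemma nonlinear_separation (K : fieldType) (charK : [pchar K] =i pred0)
    (I : finType) (js : seq I) (f : I -> {poly K}) (us : seq K) :
  uniq js -> (forall j, j \in js -> (2 < size (f j))%N) -> 0 \notin us ->
  exists a : I -> K, forall (G : seq K) (T : finType) (ex : T -> I -> nat),
    (forall g, g \in G -> exists2 l : seq K, {subset l <= us} & g = \prod_(u <- l) u) ->
    (forall u v, (forall j, j \in js -> ex u j = ex v j) -> u = v) ->
    forall c : T -> nat -> K, (forall u, linrec G (c u)) ->
    (forall m, \sum_u c u m *
       \prod_(j <- js) iter m (horner (f j)) (a j) ^+ ex u j = 0) ->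
    forall u m, c u m = 0.
Proof.
move=> ujs szf us0.
(* [cs1] lists the elements that have to stay invertible. *)
pose cs1 := us ++ [seq lead_coef (f j) | j <- js].
pose cs := cs1 ++ map GRing.inv cs1 ++ flatten [seq (f j : seq K) | j <- js].
have [R [phi [iota [gens [spec im gen]]]]] := specialization_ring charK cs.
have /choice[lift liftP] x : exists r, x \in cs -> phi r = x.
  have [xc|xc] := boolP (x \in cs).
    by have [r] := im x xc; exists r.
  by exists 0.
have [psiC ker psiC1] : exists2 psi : {rmorphism R -> algC},
    forall r, phi r = 0 -> psi r = 0 & psi 1 != 0.
  by apply: spec; rewrite rmorph1 oner_eq0.
have cs1_neq0 x : x \in cs1 -> x != 0.
  rewrite mem_cat => /orP[|/mapP[j /szf szj ->]].
    by apply: contraTneq => ->.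
  by rewrite lead_coef_eq0 -size_poly_gt0 (ltn_trans _ szj).
have cs1_cs x : x \in cs1 -> x \in cs /\ x^-1 \in cs.
  move=> xc; split; rewrite mem_cat; first by rewrite xc.
  by apply/orP; right; rewrite mem_cat (map_f GRing.inv xc).
have lift_unit (F : fieldType) (psi : {rmorphism R -> F}) x :
    (forall r, phi r = 0 -> psi r = 0) -> x \in cs1 -> psi (lift x) != 0.
  move=> kerF xc; have [xcs xVcs] := cs1_cs x xc.
  have : psi (lift x * lift x^-1 - 1) = 0.
    by apply: kerF; rewrite rmorphB rmorphM rmorph1 /= !liftP // divff ?subrr // cs1_neq0.
  rewrite rmorphB rmorphM rmorph1 => /eqP; rewrite subr_eq0 => /eqP E.
  by apply: contraTneq (oner_neq0 F) => x0; rewrite -E x0 mul0r eqxx.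
(* Lifts of the [f j] to [R], keeping their degrees. *)
pose fR j : {poly R} := \poly_(i < size (f j)) lift (f j)`_i.
have fcs j i : j \in js -> (i < size (f j))%N -> (f j)`_i \in cs.
  move=> jjs lti; rewrite mem_cat; apply/orP; right; rewrite mem_cat; apply/orP; right.
  by apply/flattenP; exists (f j : seq K); [apply: map_f | apply: mem_nth].
have lead_cs1 j : j \in js -> lead_coef (f j) \in cs1.
  by move=> jjs; rewrite mem_cat (map_f (fun j => lead_coef (f j)) jjs) orbT.
have fRphi j : j \in js -> map_poly phi (fR j) = f j.
  move=> jjs; apply/polyP => i; rewrite coef_map coef_poly.
  case: ltnP => [lti|lei]; first by rewrite /= liftP // fcs.
  by rewrite /= rmorph0 nth_default.
have fR_map (F : fieldType) (psi : {rmorphism R -> F}) j :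
    (forall r, phi r = 0 -> psi r = 0) -> j \in js ->
    size (map_poly psi (fR j)) = size (f j) /\
    lead_coef (map_poly psi (fR j)) = psi (lift (lead_coef (f j))).
  move=> kerF jjs; have lead0 := lift_unit F psi _ kerF (lead_cs1 j jjs).
  have -> : map_poly psi (fR j) = \poly_(i < size (f j)) psi (lift (f j)`_i).
    apply/polyP => i; rewrite coef_map !coef_poly.
    by case: ifP => //= _; rewrite rmorph0.
  have sz0 : (0 < size (f j))%N by rewrite (ltn_trans _ (szf j jjs)).
  have szE : size (\poly_(i < size (f j)) psi (lift (f j)`_i)) = size (f j).
    by rewrite size_poly_eq // -lead_coefE.
  by rewrite szE lead_coefE szE coef_poly ltn_predL sz0 lead_coefE.
have /choice[zC zCP] j : exists z, j \in js ->
    (map_poly psiC (fR j)).[z] = z /\ (map_poly psiC (fR j))^`().[z] != 0.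
  have [jjs|njs] := boolP (j \in js); last by exists 0.
  have [z [z1 z2]] : exists z, (map_poly psiC (fR j)).[z] = z /\
      (map_poly psiC (fR j))^`().[z] != 0.
    apply: noncritical_fixed_point.
    by have [-> _] := fR_map _ psiC j ker jjs; apply: szf.
  by exists z.
(* [sC] lists the algebraic numbers that have to be integral at the places. *)
pose dC j := (map_poly psiC (fR j))^`().[zC j].
pose sC := map psiC (map lift cs) ++ [seq (psiC (lift x))^-1 | x <- cs1] ++
  [seq zC j | j <- js] ++ [seq (dC j)^-1 | j <- js].
have [L [jL [psi [psiE imL [th genL]]]]] := number_field_factor psiC sC gen.
have /choice[pre preP] x : exists y, x \in sC -> jL y = x.
  have [xc|xc] := boolP (x \in sC).
    by have [y] := imL x xc; exists y.
  by exists 0.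
have [p0 [O0 [pl0 sO0 cop0]]] := place_sequence (map pre sC) genL.
pose k (i : I) := nat_of_ord (enum_rank i).
pose p i := p0 (k i); pose O i := O0 (k i).
have plO i : unramified_place (p i) (O i) by apply: pl0.
have sO i x : x \in sC -> pre x \in O i by move=> xc; apply/sO0/map_f.
have cop i j : i != j -> coprime (p i) (p j).
  move=> ij; apply: cop0; apply: contraNneq ij => /val_inj.
  by move/enum_rank_inj->.
have kerL r : phi r = 0 -> psi r = 0.
  by move/ker => E; apply: (fmorph_inj jL); rewrite psiE E rmorph0.
have inj := fmorph_inj jL.
have liftO i x : x \in cs -> psi (lift x) \in O i.
  move=> xc; have sCx : psiC (lift x) \in sC by rewrite mem_cat !map_f.
  have -> : psi (lift x) = pre (psiC (lift x)) by apply: inj; rewrite psiE preP.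
  exact: sO.
have liftVO i x : x \in cs1 -> (psi (lift x))^-1 \in O i.
  move=> xc; have sCx : (psiC (lift x))^-1 \in sC.
    rewrite mem_cat; apply/orP; right; rewrite mem_cat; apply/orP; left.
    by apply/mapP; exists x.
  have -> : (psi (lift x))^-1 = pre (psiC (lift x))^-1.
    by apply: inj; rewrite fmorphV psiE preP.
  exact: sO.
pose fL j := map_poly psi (fR j).
have fC j : map_poly psiC (fR j) = map_poly jL (fL j).
  by apply/polyP => i; rewrite !coef_map /= psiE.
have zsC j : j \in js -> zC j \in sC.
  by move=> jjs; rewrite !mem_cat (map_f zC jjs) !orbT.
have dsC j : j \in js -> (dC j)^-1 \in sC.
  by move=> jjs; rewrite !mem_cat (map_f (fun j => (dC j)^-1) jjs) !orbT.
pose z j := if j \in js then pre (zC j) else 0.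
have zP j : j \in js -> [/\ (fL j).[z j] = z j, (fL j)^`().[z j] != 0
    & forall i, ((fL j)^`().[z j])^-1 \in O i].
  move=> jjs; have [z1 z2] := zCP j jjs.
  have jz : jL (z j) = zC j by rewrite /z jjs preP // zsC.
  have jd : jL (fL j)^`().[z j] = dC j.
    rewrite -horner_map /= jz /dC fC; congr _.[_].
    exact: esym (deriv_map _ _).
  split; first by apply: inj; rewrite -horner_map /= jz -fC.
    by rewrite -(fmorph_eq0 jL) jd.
  move=> i; have -> : ((fL j)^`().[z j])^-1 = pre (dC j)^-1.
    by apply: inj; rewrite fmorphV jd preP // dsC.
  by apply/sO/dsC.
have zO i j : z i \in O j.
  by rewrite /z; case: ifP => [ijs|_]; [apply/sO/zsC | apply: rpred0].
(* Outside [js], where nothing is required, the default value 0 of [z] is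
   integral everywhere. *)
have [N NP] := starting_points plO cop zO.
pose a i : rat := (N i)%:R / (p i)%:R.
have psi_a i : psi (iota (a i)) = (N i)%:R / (p i)%:R.
  by rewrite -[LHS]/((psi \o iota) (a i)) /a fmorph_div !rmorph_nat.
exists (fun i => phi (iota (a i))) => G T ex Gus exI c crec rel.
have /choice[eG eGP] g : exists l : seq K, g \in G ->
    {subset l <= us} /\ g = \prod_(u <- l) u.
  have [/Gus[l lus ->]|nG] := boolP (g \in G); first by exists l.
  by exists [::].
pose GR := [seq \prod_(u <- eG g) lift u | g <- G].
have us_cs1 u : u \in us -> u \in cs1 by rewrite mem_cat => ->.
have GRphi : map phi GR = G.
  rewrite -map_comp -[RHS]map_id; apply/eq_in_map => g gG /=.
  have [lus Eg] := eGP g gG; rewrite [RHS]Eg rmorph_prod.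
  apply: eq_big_seq => u /lus uus.
  by rewrite /= liftP //; have [] := cs1_cs u (us_cs1 u uus).
pose Y j m := iter m (horner (fR j)) (iota (a j)).
apply: (separation_lift kerL (js := js) (Y := Y) (G := GR) (ex := ex) exI); last 1 first.
- move=> m; rewrite -[RHS](rel m); apply: eq_bigr => u _; congr (_ * _).
  by apply: eq_big_seq => j jjs; rewrite /Y iter_rmorph fRphi.
- move=> c' crec' rel'.
  pose y j m := iter m (horner (fL j)) ((N j)%:R / (p j)%:R).
  apply: (linrec_separation (y := y) (p := p) (O := O) (G := map psi GR)) => //.
  + move=> i ijs; have [a0 aV _] := NP i.
    have [szE leadE] := fR_map _ psi i kerL ijs.
    apply: (escaping_iterate (plO i)) => //; rewrite ?szE ?szf //.
      apply/polyOverP => l; rewrite coef_map coef_poly.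
      case: ifP => [lti|_]; last by rewrite /= rmorph0 rpred0.
      by rewrite /= liftO // fcs.
    by rewrite leadE liftVO // lead_cs1.
  + move=> i j ijs jjs ij; have [fz d0 dV] := zP j jjs.
    have [_ _ az] := NP j.
    apply: (recurrent_iterate (plO i) _ (zO j i) fz d0 (dV i)).
      apply/polyOverP => l; rewrite coef_map coef_poly.
      case: ifP => [lti|_]; last by rewrite /= rmorph0 rpred0.
      by rewrite /= liftO // fcs.
    by apply: az; rewrite eq_sym.
  + move=> i _ ijs /mapP[_ /mapP[g gG ->] ->].
    have [lus _] := eGP g gG; rewrite rmorph_prod; split.
    * rewrite big_seq rpred_prod // => u /lus uus.
      by apply: liftO; have [] := cs1_cs u (us_cs1 u uus).
    * rewrite -prodfV big_seq rpred_prod // => u /lus uus.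
      by rewrite liftVO // us_cs1.
    rewrite prodf_seq_neq0; apply/allP => u /lus uus /=.
    by rewrite lift_unit // us_cs1.
  move=> m; rewrite -[RHS](rel' m); apply: eq_bigr => u _; congr (_ * _).
  by apply: eq_big_seq => j jjs; rewrite /Y iter_rmorph psi_a.
by rewrite GRphi.
Qed.
(** * The slopes of the linear coordinates *)

Lemma prod_exprz (K : fieldType) (x : K) (I : Type) (r : seq I) (P : pred I)
    (e : I -> int) : x != 0 ->
  \prod_(i <- r | P i) x ^ e i = x ^ (\sum_(i <- r | P i) e i).
Proof.
by move=> x0; rewrite (big_morph _ (fun a b => expfzDr a b x0) (expr0z x)).
Qed.

Lemma common_denominator (s : seq rat) :
  exists2 d : int, d != 0 & forall x, x \in s -> exists z : int, d%:~R * x = z%:~R.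
Proof.
elim: s => [|x s [d d0 IH]]; first by exists 1.
exists (d * denq x); first by rewrite mulf_neq0 ?denq_neq0.
move=> y; rewrite inE => /predU1P[->|/IH[z E]].
  by exists (d * numq x); rewrite !intrM -mulrA [_ * x]mulrC -numqE.
by exists (z * denq x); rewrite !intrM mulrAC E.
Qed.

(** A group with [r] generators that contains [r] independent elements is free on
    the generators.  A relation [e] between the [b j] would make the [r] rows of
    [E] dependent modulo [e]; some nonzero integral combination [W] of the rows
    is then a multiple of [e], and gives a relation between the [t k]. *)
Lemma independent_generators (K : fieldType) (r : nat) (b t : 'I_r -> K)
    (E : 'I_r -> 'I_r -> int) :
  (forall j, b j != 0) -> (forall k, t k = \prod_j b j ^ E k j) ->
  (forall w : 'I_r -> int, \prod_k t k ^ w k = 1 -> forall k, w k = 0) ->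
  forall e : 'I_r -> int, \prod_j b j ^ e j = 1 -> forall j, e j = 0.
Proof.
move=> b0 tE t_indep e rel; apply: contrapT => /existsNP[j0 ej0].
pose v : 'rV[rat]_r := \row_j (e j)%:~R.
pose A : 'M[rat]_r := \matrix_(k, j) (E k j)%:~R.
have v0 : v != 0.
  apply: contra_not_neq ej0 => /rowP/(_ j0); rewrite !mxE => /eqP.
  by rewrite intr_eq0 => /eqP.
have : kermx (A *m cokermx v) != 0.
  rewrite -mxrank_eq0 mxrank_ker subn_eq0 -ltnNge.
  rewrite (leq_ltn_trans (mxrankM_maxr _ _)) // mxrank_coker rank_rV v0.
  by rewrite -subn_gt0 subKn ?(leq_ltn_trans _ (ltn_ord j0)).
case/rowV0Pn => w /sub_kermxP; rewrite mulmxA => /eqP; rewrite -submxE.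
case/sub_rVP => c wA w0.
have [d d0 dP] := common_denominator (c :: [seq w 0 k | k <- enum 'I_r]).
have [C CE] := dP c (mem_head _ _).
have /choice[W WE] k : exists z : int, d%:~R * w 0 k = z%:~R.
  by apply: dP; rewrite inE map_f ?orbT ?mem_enum.
have WC j : \sum_k E k j * W k = e j * C.
  apply/eqP; rewrite -(eqr_int rat) rmorph_sum intrM -CE /=; apply/eqP.
  have /rowP/(_ j) := wA; rewrite !mxE => /(congr1 ( *%R d%:~R)).
  rewrite mulr_sumr mulrA mulrC => <-; apply: eq_bigr => k _.
  by rewrite !mxE intrM -WE; ring.
case/eqP: w0; apply/rowP => k; rewrite mxE.
suff W0 : W k = 0.
  by have := WE k; rewrite W0 => /eqP; rewrite mulf_eq0 intr_eq0 (negPf d0) => /eqP.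
move: k; apply: t_indep.
under eq_bigr => k _ do rewrite tE (big_morph _ (fun x y => expfzMl x y (W k)) (exp1rz _ (W k))).
rewrite exchange_big /=.
under eq_bigr => j _.
  under eq_bigr => k _ do rewrite exprz_exp.
  rewrite prod_exprz // WC -exprz_exp.
over.
by rewrite -(big_morph _ (fun x y => expfzMl x y C) (exp1rz _ C)) rel exp1rz.
Qed.
Lemma mult_independent_map (K : fieldType) (I : eqType) (s : seq I) (al : I -> K)
    (e : I -> int) : uniq s -> mult_independent (map al s) ->
  \prod_(i <- s) al i ^ e i = 1 -> forall i, i \in s -> e i = 0.
Proof.
move=> us [_ indep] rel i0 i0s.
have /indep H : exp_prod (s := map al s) (fun k => e (nth i0 s k)) = 1.
  rewrite /exp_prod -(big_mkord xpredT (fun k => (map al s)`_k ^ e (nth i0 s k))).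
  rewrite size_map -[RHS]rel (big_nth i0); apply: eq_big_nat => k /andP[_ ltk].
  by rewrite (nth_map i0).
have lti : (index i0 s < size (map al s))%N by rewrite size_map index_mem.
by have := H (Ordinal lti); rewrite /= nth_index.
Qed.

Lemma mult_group_map (K : fieldType) (I : eqType) (s : seq I) (al : I -> K) (x : K) :
  uniq s -> mult_group (map al s) x ->
  exists e : I -> int, x = \prod_(i <- s) al i ^ e i.
Proof.
case: s => [|i0 s'] us [e ->]; first by exists (fun=> 0); rewrite /exp_prod big_ord0 big_nil.
set s := i0 :: s' in us e *.
exists (fun i => if insub (index i s) is Some k then e k else 0).
rewrite (big_nth i0) -(size_map al) big_mkord; apply: eq_bigr => k _.
have ltk : (k < size s)%N by rewrite -(size_map al).
by rewrite index_uniq // valK (nth_map i0).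
Qed.

(** In the case of rank [r - 1], one slope is 1, so the others generate the group
    and [independent_generators] shows that they are independent; in particular
    none of them is 1. *)
Lemma independent_linear_data (K : fieldType) (n : nat) (f : 'I_n -> {poly K}) :
  independent_linear [seq p <- [seq f i | i <- enum 'I_n] | linear_poly p] ->
  [/\ forall i, linear_poly (f i) -> (f i)`_1 = 1 -> (f i)`_0 != 0,
      forall i j, linear_poly (f i) -> linear_poly (f j) ->
        (f i)`_1 = 1 -> (f j)`_1 = 1 -> i = j
    & forall e : 'I_n -> int,
        \prod_(i | linear_poly (f i) && ((f i)`_1 != 1)) (f i)`_1 ^ e i = 1 ->
        forall i, linear_poly (f i) -> (f i)`_1 != 1 -> e i = 0].
Proof.
pose al i := (f i)`_1; pose li := [seq i <- enum 'I_n | linear_poly (f i)].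
have uli : uniq li by rewrite filter_uniq ?enum_uniq.
have liE i : (i \in li) = linear_poly (f i) by rewrite mem_filter mem_enum andbT.
have al0 i : linear_poly (f i) -> al i != 0.
  move=> /eqP szf; have : lead_coef (f i) != 0.
    by rewrite lead_coef_eq0 -size_poly_eq0 szf.
  by rewrite lead_coefE szf.
rewrite filter_map -/li => -[_].
have -> : slopes [seq f i | i <- li] = map al li.
  rewrite /slopes -map_comp; apply: eq_map => i /=.
  by rewrite horner_coef0 coef_deriv mulr1n.
move=> H.
suff [s [us s_lin s_indep s_one s_uniq]] : exists s : seq 'I_n, [/\ uniq s,
    forall i, i \in s -> linear_poly (f i),
    forall e : 'I_n -> int, \prod_(i <- s) al i ^ e i = 1 ->
      forall i, i \in s -> e i = 0,
    forall i, linear_poly (f i) -> i \notin s -> al i = 1 /\ (f i)`_0 != 0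
    & forall i j, linear_poly (f i) -> linear_poly (f j) ->
        i \notin s -> j \notin s -> i = j].
  have s_neq1 i : i \in s -> al i != 1.
    move=> si; apply/eqP => ai; have := s_indep (fun j => (j == i)%:Z) _ i si.
    move=> z; suff /z : \prod_(k <- s) al k ^ (k == i)%:Z = 1 by rewrite eqxx.
    rewrite (big_rem i) //= eqxx expr1z ai mul1r big_seq big1 // => j.
    by rewrite mem_rem_uniq // inE => /andP[/negPf->]; rewrite expr0z.
  have sE i : (i \in s) = linear_poly (f i) && (al i != 1).
    apply/idP/andP => [si|[li1 ai]]; first by rewrite s_lin ?s_neq1.
    by apply: contraT => nsi; have [/eqP] := s_one i li1 nsi; rewrite (negPf ai).
  split.
  - move=> i li1 ai; have [] // := s_one i li1.
    by rewrite sE /al li1 /= ai eqxx.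
  - by move=> i j li1 lj1 ai aj; apply: s_uniq => //; rewrite sE /al ?ai ?aj eqxx andbF.
  move=> e rel i li1 ai; apply: s_indep; last by rewrite sE li1.
  rewrite -[RHS]rel -[RHS]big_filter; apply: perm_big; apply: uniq_perm => //.
    by rewrite filter_uniq ?index_enum_uniq.
  by move=> j; rewrite mem_filter mem_index_enum andbT sE.
case: H => [indep|[[[t [szt tG tindep]] _] [b b0 Xb]]].
  exists li; split=> // [i|e|i li1|i j li1 lj1]; rewrite ?liE ?li1 //.
  exact: mult_independent_map.
have /mapP[i0 i0li fi0] := Xb.
have ai0 : al i0 = 1 by rewrite /al -fi0 coefD coefX coefC addr0.
exists (rem i0 li); have urem := rem_uniq i0 uli.
have remE i : (i \in rem i0 li) = (i != i0) && linear_poly (f i).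
  by rewrite mem_rem_uniq // inE liE.
split=> // [i|e rel|i li1|i j li1 lj1].
- by rewrite remE => /andP[].
- have szr : size (rem i0 li) = size t by rewrite size_rem // szt size_map.
  have rem_lin k : (k < size t)%N -> linear_poly (f (nth i0 (rem i0 li) k)).
    by rewrite -szr => /(mem_nth i0); rewrite remE => /andP[].
  have /choice[E EP] (k : 'I_(size t)) : exists e : 'I_n -> int,
      t`_k = \prod_(i <- rem i0 li) al i ^ e i.
    have [e' ->] := mult_group_map uli (tG _ (mem_nth 0 (ltn_ord k))).
    by exists e'; rewrite (big_rem i0) //= ai0 exp1rz mul1r.
  have big_r (e' : 'I_n -> int) : \prod_(i <- rem i0 li) al i ^ e' i =
      \prod_(j < size t) al (nth i0 (rem i0 li) j) ^ e' (nth i0 (rem i0 li) j).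
    by rewrite (big_nth i0) szr big_mkord.
  have := @independent_generators _ _ (fun j : 'I_(size t) => al (nth i0 (rem i0 li) j))
    (fun k => t`_k) (fun k j => E k (nth i0 (rem i0 li) j)).
  move=> /(_ _ _ _ (fun j => e (nth i0 (rem i0 li) j))) gen.
  move=> i ir; have lti : (index i (rem i0 li) < size t)%N by rewrite -szr index_mem.
  rewrite -(nth_index i0 ir); apply: (gen _ _ _ _ (Ordinal lti)) => [j|k|w|].
  + by rewrite al0 // rem_lin.
  + by rewrite EP big_r.
  + by move=> relw; apply: tindep.2.
  by rewrite -big_r.
- rewrite remE li1 andbT negbK => /eqP->.
  by rewrite ai0 -fi0 coefD coefX coefC add0r.
by rewrite !remE li1 lj1 !andbT !negbK => /eqP-> /eqP->.
Qed.
(** * Density of the orbit *)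

(** The coordinates of the orbit after translation, in three classes: nonlinear
    ([NL]), geometric ([act]), and at most one further coordinate, which is the
    sequence [m * bt i]. *)
Section SplitSequences.
Variables (K : fieldType) (n : nat) (NL act : pred 'I_n) (al bt : 'I_n -> K)
  (y : 'I_n -> nat -> K).
Hypothesis charK : [pchar K] =i pred0.
Hypothesis act_NL : forall i, act i -> ~~ NL i.
Hypothesis al0 : forall i, act i -> al i != 0.
Hypothesis bt0 : forall i, ~~ NL i -> ~~ act i -> bt i != 0.
Hypothesis rest_unique : forall i j,
  ~~ NL i -> ~~ act i -> ~~ NL j -> ~~ act j -> i = j.
Hypothesis al_indep : forall e : 'I_n -> int,
  \prod_(i | act i) al i ^ e i = 1 -> forall i, act i -> e i = 0.
Hypothesis sep : forall (G : seq K) (T : finType) (ex : T -> 'I_n -> nat),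
  (forall g, g \in G -> exists2 l : seq K,
     {subset l <= [seq al i | i <- enum act]} & g = \prod_(u <- l) u) ->
  (forall u v, (forall j, j \in enum NL -> ex u j = ex v j) -> u = v) ->
  forall c : T -> nat -> K, (forall u, linrec G (c u)) ->
  (forall m, \sum_u c u m * \prod_(j <- enum NL) y j m ^+ ex u j = 0) ->
  forall u m, c u m = 0.

Definition split_sequence i m : K :=
  if NL i then y i m else if act i then al i ^+ m else m%:R * bt i.

Local Notation mon := 'X_{1..n}.

Definition nl_part (u : mon) : {ffun 'I_n -> nat} :=
  [ffun i => if NL i then u i else 0%N].
Definition multiplier (u : mon) : K := \prod_(i | act i) al i ^+ u i.
Definition rest : pred 'I_n := fun i => ~~ NL i && ~~ act i.
Definition rest_degree (u : mon) : nat := (\sum_(i | rest i) u i)%N.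
Definition rest_coef (u : mon) : K := \prod_(i | rest i) bt i ^+ u i.

Lemma multiplier_neq0 u : multiplier u != 0.
Proof. by apply/prodf_neq0 => i /al0 ai; rewrite expf_neq0. Qed.

Lemma rest_coef_neq0 u : rest_coef u != 0.
Proof. by apply/prodf_neq0 => i /andP[i1 i2]; rewrite expf_neq0 ?bt0. Qed.

Lemma monomial_value (u : mon) m : \prod_i split_sequence i m ^+ u i =
  rest_coef u * m%:R ^+ rest_degree u * multiplier u ^+ m *
  \prod_(j <- enum NL) y j m ^+ nl_part u j.
Proof.
rewrite (bigID NL) /= mulrC; congr (_ * _).
  rewrite (bigID act) /= mulrC; congr (_ * _).
    rewrite /rest_coef /rest_degree -prodrXr -big_split /=.
    apply: eq_bigr => i /andP[/negPf n1 /negPf n2].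
    by rewrite /split_sequence n1 n2 -exprMn mulrC.
  rewrite /multiplier -prodrXl; apply: eq_big => i.
    by rewrite andbC; case ai: (act i); rewrite // act_NL.
  move=> /andP[/negPf ni ai].
  by rewrite /split_sequence ni ai -!exprM mulnC.
rewrite big_enum /=; apply: eq_bigr => i ni.
by rewrite /split_sequence /nl_part ffunE [NL i]ni.
Qed.

Lemma monomial_key (u v : mon) : nl_part u = nl_part v ->
  multiplier u = multiplier v -> rest_degree u = rest_degree v -> u = v.
Proof.
move=> nl_eq mult_eq deg_eq; apply/mnmP => i.
have [ni|ni] := boolP (NL i).
  by have /ffunP/(_ i) := nl_eq; rewrite !ffunE ni.
have [ai|ai] := boolP (act i).
  have rel : \prod_(j | act j) al j ^ ((u j)%:Z - (v j)%:Z) = 1.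
    rewrite -[RHS](divff (multiplier_neq0 v)) -{1}mult_eq /multiplier -prodf_div.
    apply: eq_bigr => j aj; rewrite expfzDr ?al0 //.
    by rewrite exprnN.
  by have /eqP := al_indep rel ai; rewrite subr_eq0 => /eqP[].
have big_rest (w : mon) : rest_degree w = w i.
  rewrite /rest_degree (big_pred1 i) // => j; rewrite /rest.
  apply/andP/eqP => [[nj aj]|->] //; exact: rest_unique.
by rewrite -!big_rest.
Qed.

(** Monomials are first grouped by their exponents on [NL], and [sep] shows that
    each group vanishes.  Within a group, they are exponential polynomials, and
    [exp_poly_free] separates those with different multipliers; what remains is
    distinguished by the degree in [m], by [monomial_key]. *)
Lemma split_sequences_free (q : {mpoly K[n]}) :
  (forall m, q.@[fun i => split_sequence i m] = 0) -> q = 0.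
Proof.
move=> rel; apply/eqP; rewrite -msupp_eq0; apply/eqP.
case Esupp: (msupp q) => [//|u0 s]; exfalso.
have {Esupp s} u0q : u0 \in msupp q by rewrite Esupp inE eqxx.
pose U := [seq nl_part u | u <- msupp q].
pose T : finType := seq_sub U.
pose P u : {poly K} := (q@_u * rest_coef u) *: 'X^(rest_degree u).
pose c (t : T) m : K := \sum_(u <- msupp q | nl_part u == val t)
  (P u).[m%:R] * multiplier u ^+ m.
pose G := flatten [seq nseq (size (P u)) (multiplier u) | u <- msupp q].
have c0 (t : T) m : c t m = 0.
  apply: (sep (G := G) (ex := fun (t : T) i => val t i)) => [g|t1 t2 E|t'|m'].
  - case/flattenP => _ /mapP[u _ ->] /nseqP[-> _].
    pose ok x := exists2 l : seq K,
      {subset l <= [seq al i | i <- enum act]} & x = \prod_(w <- l) w.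
    apply: (big_ind ok) => [|_ _ [l1 s1 ->] [l2 s2 ->]|i ai].
    + by exists [::]; rewrite ?big_nil.
    + exists (l1 ++ l2); rewrite ?big_cat // => x.
      by rewrite mem_cat => /orP[/s1|/s2].
    exists (nseq (u i) (al i)); last by rewrite big_nseq -iter_mulr_1.
    by move=> x /nseqP[-> _]; rewrite map_f // mem_enum.
  - apply: val_inj; apply/ffunP => i.
    have [ni|ni] := boolP (NL i); first by rewrite E // mem_enum.
    have z (t' : T) : val t' i = 0%N.
      by have /mapP[w _ ->] := valP t'; rewrite ffunE (negPf ni).
    by rewrite !z.
  - apply: linrec_sum => u uq _.
    apply: exp_poly_linrec; rewrite /G count_flatten -map_comp.
    rewrite sumnE big_map (big_rem u) //= (leq_trans _ (leq_addr _ _)) //.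
    by rewrite count_nseq /= eqxx mul1n.
  rewrite -[RHS](rel m') mevalE.
  under eq_bigr do rewrite /c mulr_suml big_mkcond.
  rewrite exchange_big /= big_seq [RHS]big_seq; apply: eq_bigr => u uq.
  have uU : nl_part u \in U by apply: map_f.
  rewrite (bigD1 (Sub (nl_part u) uU : T)) //= eqxx [X in _ + X]big1 ?addr0.
    by rewrite monomial_value /P hornerZ hornerXn; ring.
  move=> t' ne; case: eqP => // E; case/eqP: ne; apply: val_inj.
  by rewrite /= -E.
pose t0 : T := Sub (nl_part u0) (map_f _ u0q).
pose Gam := undup [seq multiplier u | u <- msupp q].
pose Q g := \sum_(u <- msupp q | (nl_part u == nl_part u0) && (multiplier u == g)) P u.
have Q0 : Q (multiplier u0) = 0.
  apply: (exp_poly_free charK (G := Gam)) => [||m|].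
  - exact: undup_uniq.
  - rewrite mem_undup; apply/mapP => -[u _ /esym/eqP].
    by rewrite (negPf (multiplier_neq0 u)).
  - rewrite -[RHS](c0 t0 m) /c.
    under eq_bigr do rewrite /Q horner_sum mulr_suml big_mkcond.
    rewrite exchange_big /= [RHS]big_mkcond /= big_seq [RHS]big_seq.
    apply: eq_bigr => u uq; case: (nl_part u == nl_part u0) => /=; last exact: big1_eq.
    rewrite (bigD1_seq (multiplier u)) ?undup_uniq //=; last by rewrite mem_undup map_f.
    rewrite eqxx [X in _ + X]big1 ?addr0 // => g.
    by rewrite eq_sym => /negPf->.
  by rewrite mem_undup map_f.
have := congr1 (fun r : {poly K} => r`_(rest_degree u0)) Q0.
rewrite coef0 coef_sum big_mkcond (bigD1_seq u0) ?msupp_uniq //= !eqxx.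
rewrite [X in _ + X]big1 ?addr0.
  rewrite coefZ coefXn eqxx mulr1 => /eqP; rewrite mulf_eq0.
  by rewrite (negPf (rest_coef_neq0 u0)) orbF; apply/negP; rewrite -mcoeff_msupp.
move=> u ne; case: ifP => // /andP[/eqP nl_eq /eqP mult_eq].
rewrite coefZ coefXn; case: eqP => [deg_eq|_]; last by rewrite mulr0.
by case/eqP: ne; apply: monomial_key.
Qed.
End SplitSequences.

Lemma comp_mpoly_shift (K : fieldType) (n : nat) (b : 'I_n -> K) (p : {mpoly K[n]}) :
  (p \mPo [tuple 'X_i + (b i)%:MP | i < n]) \mPo [tuple 'X_i - (b i)%:MP | i < n] = p.
Proof.
rewrite (comp_mpolyEX p) rmorph_sum /= -[RHS]comp_mpoly_id.
rewrite [RHS]comp_mpolyEX; apply: eq_bigr => m _.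
rewrite linearZ /= !comp_mpolyX rmorph_prod; congr (_ *: _).
apply: eq_bigr => i _; rewrite rmorphXn /= !tnth_mktuple.
by rewrite rmorphD /= comp_mpolyC comp_mpolyXU -tnth_nth tnth_mktuple subrK.
Qed.

Lemma iter_split_map (K : fieldType) (n : nat) (f : 'I_n -> {poly K}) a m i :
  iter m (split_map f) a i = iter m (horner (f i)) (a i).
Proof. by elim: m => //= m IH; rewrite ffunE IH. Qed.

Lemma horner_linear (K : fieldType) (p : {poly K}) (x : K) : size p = 2 ->
  p.[x] = p`_0 + p`_1 * x.
Proof.
by move=> szp; rewrite horner_coef szp !big_ord_recl big_ord0 mulr1 expr1 addr0.
Qed.

Lemma iter_linear (K : fieldType) (p : {poly K}) m : size p = 2 -> p`_1 != 1 ->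
  let b := p`_0 / (1 - p`_1) in iter m (horner p) (b + 1) = p`_1 ^+ m + b.
Proof.
move=> szp p1 b; elim: m => [|m /= ->]; first by rewrite addrC.
rewrite horner_linear // exprS mulrDr addrCA; congr (_ + _).
by rewrite /b; field; rewrite subr_eq0 eq_sym.
Qed.

Lemma iter_translation (K : fieldType) (p : {poly K}) m : size p = 2 -> p`_1 = 1 ->
  iter m (horner p) 0 = m%:R * p`_0.
Proof.
move=> szp p1; elim: m => [|m /= ->]; first by rewrite mul0r.
by rewrite horner_linear // p1 mul1r -natr1 mulrDl mul1r addrC.
Qed.

Unset Implicit Arguments.

(** A geometric coordinate starts at distance 1 from the fixed point [shift i] of
    [f i], the remaining linear coordinate at 0, and the nonlinear ones at the
    points given by [nonlinear_separation]. *)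
Theorem theorem7p16 (K : fieldType) (charK : [pchar K] =i pred0)
    (n : nat) (f : 'I_n -> {poly K})
    (f_nonconstant : forall i : 'I_n, (1 < size (f i))%N)
    (f_independent :
       independent_linear [seq p <- [seq f i | i <- enum 'I_n] | linear_poly p]) :
  exists a : {ffun 'I_n -> K}, zariski_dense (forward_orbit (split_map f) a).
Proof.
have [b0 one_translation al_indep] := independent_linear_data f_independent.
pose NL : pred 'I_n := fun i => (2 < size (f i))%N.
pose al i := (f i)`_1.
pose act : pred 'I_n := fun i => linear_poly (f i) && (al i != 1).
have linE i : ~~ NL i = linear_poly (f i).
  by rewrite /NL /linear_poly -leqNgt eqn_leq f_nonconstant andbT.
have actNL i : act i -> ~~ NL i by rewrite linE => /andP[].
have al0 i : linear_poly (f i) -> al i != 0.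
  move=> /eqP szf; have : lead_coef (f i) != 0.
    by rewrite lead_coef_eq0 -size_poly_eq0 szf.
  by rewrite lead_coefE szf.
have [//|||aN sep] := nonlinear_separation charK (js := enum NL) (f := f)
  (us := [seq al i | i <- enum act]).
- exact: enum_uniq.
- by move=> j; rewrite mem_enum.
- apply/mapP => -[i]; rewrite mem_enum => /andP[/al0 ai _] /esym/eqP.
  by rewrite (negPf ai).
(* The fixed point of [f i]. *)
pose shift i := if act i then (f i)`_0 / (1 - al i) else 0.
pose a : {ffun 'I_n -> K} := [ffun i => if NL i then aN i else
  if act i then shift i + 1 else 0].
pose y i m := iter m (horner (f i)) (aN i).
pose x := split_sequence NL act al (fun i => (f i)`_0) y.
have orbitE m i : iter m (split_map f) a i = x i m + shift i.
  rewrite iter_split_map ffunE /x /split_sequence /shift.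
  case ni: (NL i); first by rewrite ifN ?addr0 //; apply: contraL ni; apply: actNL.
  have li : linear_poly (f i) by rewrite -linE ni.
  have szf : size (f i) = 2 by apply/eqP.
  case ai: (act i); first by apply: iter_linear; case/andP: ai.
  rewrite addr0; apply: iter_translation => //; apply/eqP.
  by move: ai; rewrite /act li => /negbT; rewrite negbK.
exists a => Z [P ZP] orbit_Z pt; apply/ZP => p Pp.
suff -> : p = 0 by apply: rpred0.
have vanish m : p.@[iter m (split_map f) a] = 0.
  have Zm := orbit_Z _ (ex_intro _ m erefl).
  exact/eqP/((ZP _).1 Zm p Pp).
rewrite -(comp_mpoly_shift shift p); set q := p \mPo _.
suff -> : q = 0 by rewrite comp_mpoly0.
apply: (split_sequences_free (NL := NL) (act := act) (al := al)
  (bt := fun i => (f i)`_0) (y := y) charK) => //.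
- by move=> i /andP[/al0].
- move=> i; rewrite linE => li nai; apply: b0 => //; apply/eqP.
  by move: nai; rewrite /act li negbK.
- move=> i j; rewrite !linE /act => li; rewrite li negbK => /eqP ai lj.
  by rewrite lj negbK => /eqP aj; apply: one_translation.
- by move=> e rel i /andP[li ai]; apply: al_indep rel i li ai.
move=> m; rewrite /q comp_mpoly_meval -[RHS](vanish m).
apply: meval_eq => i; rewrite tnth_mktuple orbitE.
by rewrite mevalD mevalXU mevalC.
Qed.
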